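(* Let $\diamond$ be a monotonic generalized convolution on $\mathcal{P}_+$ with probability kernel $\varphi$. Then the following conditions are equivalent: 1) $\varphi$ is monotonically decreasing (i.e. non-increasing) on $[0,\infty)$ and $\varphi(+\infty):=\lim_{t\to\infty}\varphi(t)=0$; 2) $(1-\varphi(t))\mathbf{1}_{[0,\infty)}(t)$ is the distribution function of a measure in $\mathcal{P}_+$ with the lack of memory property with respect to $\diamond$; 3) $\varphi(t^{-1})\mathbf{1}_{[0,\infty)}(t)$ is the cumulative distribution function of some probability measure.
   Context: $\mathcal{P}_+$ is the set of Borel probability measures on $[0,\infty)$; $T_a\mu$ ($a\ge0$) is the law of $aX$ when $X\sim\mu$; $\Rightarrow$ is weak convergence. A generalized convolution is a binary, associative and commutative operation $\diamond$ on $\mathcal{P}_+$ such that: (i) $\lambda\diamond\delta_0=\lambda$; (ii) $(p\lambda_1+(1-p)\lambda_2)\diamond\lambda=p(\lambda_1\diamond\lambda)+(1-p)(\lambda_2\diamond\lambda)$ for $p\in[0,1]$; (iii) $T_a(\lambda_1\diamond\lambda_2)=(T_a\lambda_1)\diamond(T_a\lambda_2)$ for $a\ge0$; (iv) $\lambda_n\Rightarrow\lambda$ and $\nu_n\Rightarrow\nu$ imply $\lambda_n\diamond\nu_n\Rightarrow\lambda\diamond\nu$; (v) there exist positive numbers $c_n$ and $\nu\in\mathcal{P}_+$, $\nu\ne\delta_0$, with $T_{c_n}\delta_1^{\diamond n}\Rightarrow\nu$. A probability kernel of $\diamond$ is a Borel function $\varphi:[0,\infty)\to\mathbb{R}$ with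 $|\varphi(t)|\le\varphi(0)=1$ such that: the transform $\widehat\lambda(t)=\int_0^\infty\varphi(tx)\lambda(dx)$ separates points of $\mathcal{P}_+$; weak convergence $\lambda_n\Rightarrow\lambda$ in $\mathcal{P}_+$ is equivalent to $\int\widehat{\lambda_n}\,g\,dm_0\to\int\widehat{\lambda}\,g\,dm_0$ for all $g\in L_1(m_0)$, where $m_0$ is the sum of $\delta_0$ and Lebesgue measure on $[0,\infty)$; and $$\varphi(xt)\varphi(yt)=\int_0^\infty\varphi(st)\,(\delta_x\diamond\delta_y)(ds),\qquad x,y,t\ge0.$$ ($\varphi$ need not be continuous.) $\diamond$ is monotonic if $(\delta_x\diamond\delta_y)([\max\{x,y\},\infty))=1$ for all $x,y\ge0$. A measure $\nu\in\mathcal{P}_+$, $\nu\neq\delta_0$, has the lack of memory property with respect to $\diamond$ if $\mathbf{P}\{X>x\diamond y\mid X>x\}=\mathbf{P}\{X>y\}$ for $x,y\ge0$, where $X\sim\nu$ and $x\diamond y$ is a random variable with law $\delta_x\diamond\delta_y$ independent of $X$; for monotonic $\diamond$ this is understood as $\mathbf{P}\{X>x\diamond y\}=\mathbf{P}\{X>x\}\,\mathbf{P}\{X>y\}$ for all $x,y\ge0$. Convention: at $t=0$, $\varphi(t^{-1})$ means $\varphi(+\infty)$. A function is said to be the (cumulative) distribution function of a measure $\nu$ if it agrees with $t\mapsto\nu((-\infty,t])$ at every continuity point of the latter. *)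

(* Defs.v *)
From HB Require Import structures.
From mathcomp Require Import all_boot all_order all_algebra.
From mathcomp Require Import interval_inference.
From mathcomp Require Import all_classical all_reals all_analysis.
From mathcomp Require Import measurable_realfun giry.
Import Order.TTheory GRing.Theory Num.Theory.
Import numFieldNormedType.Exports.

Set Implicit Arguments.
Unset Strict Implicit.
Unset Printing Implicit Defensive.

Local Open Scope classical_set_scope.
Local Open Scope ring_scope.

(* Borel probability measures on [0, +oo[, represented as Borel probability
   measures on the line that give mass 1 to [0, +oo[.  Since library measures
   are functions on all sets, equality of measures is always [measure_eq]
   (agreement on measurable sets), never Leibniz equality. *)
Record pplus (R : realType) := Pplus {
  law :> probability (measurableTypeR R) R ;
  law_ge0 : law `[0, +oo[%classic = 1%E }.

Section pplus_operations.
Context {R : realType}.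
Implicit Types (lambda : pplus R) (a x : {nonneg R}).

Lemma delta_subproof x :
  (\d_(x%:num : measurableTypeR R) : probability (measurableTypeR R) R)
    `[0, +oo[%classic = 1%E.
Proof. by rewrite /= diracE mem_set//= in_itv/= andbT. Qed.

Definition delta x : pplus R :=
  @Pplus R (\d_(x%:num : measurableTypeR R)) (delta_subproof x).

Definition scaling a (s : measurableTypeR R) : measurableTypeR R := a%:num * s.

Lemma measurable_scaling a : measurable_fun setT (scaling a).
Proof. exact: mulrl_measurable. Qed.

HB.instance Definition _ a :=
  isMeasurableFun.Build _ _ _ _ (scaling a) (measurable_scaling a).

Lemma dilation_subproof a lambda :
  (distribution lambda (scaling a) : probability (measurableTypeR R) R)
    `[0, +oo[%classic = 1%E.
Proof.
apply/eqP; rewrite eq_le probability_le1//= -(law_ge0 lambda).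
rewrite /distribution /pushforward le_measure// ?inE//.
- by rewrite -[X in measurable X]setTI; exact: measurable_scaling.
- by move=> s /=; rewrite !in_itv/= !andbT => s0; rewrite /scaling mulr_ge0.
Qed.

Definition dilation a lambda : pplus R :=
  @Pplus R (distribution lambda (scaling a)) (dilation_subproof a lambda).

Definition mix_measure (p : {i01 R}) lambda1 lambda2 :=
  measure_add (mscale (p%:num)%:nng lambda1)
    (mscale (1 - p%:num)%:nng lambda2).

HB.instance Definition _ p lambda1 lambda2 :=
  Measure.on (mix_measure p lambda1 lambda2).

Lemma mix_measureE p lambda1 lambda2 A : mix_measure p lambda1 lambda2 A =
  ((p%:num)%:E * lambda1 A + (1 - p%:num)%:E * lambda2 A)%E.
Proof. exact: measure_addE. Qed.

Lemma mix_measure_setT p lambda1 lambda2 :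
  mix_measure p lambda1 lambda2 setT = 1%E.
Proof. by rewrite mix_measureE !probability_setT !mule1 -EFinD subrKC. Qed.

HB.instance Definition _ p lambda1 lambda2 :=
  Measure_isProbability.Build _ _ _ (mix_measure p lambda1 lambda2)
    (mix_measure_setT p lambda1 lambda2).

Lemma mix_subproof p lambda1 lambda2 :
  (mix_measure p lambda1 lambda2 : probability (measurableTypeR R) R)
    `[0, +oo[%classic = 1%E.
Proof. by rewrite [LHS]mix_measureE !law_ge0 !mule1 -EFinD subrKC. Qed.

Definition mix p lambda1 lambda2 : pplus R :=
  @Pplus R (mix_measure p lambda1 lambda2) (mix_subproof p lambda1 lambda2).

Definition weak_cvg (l : nat -> pplus R) lambda : Prop :=
  forall f : R -> R, continuous f -> bounded_fun f ->
    (fun n => \int[l n]_x f x) @ \oo --> \int[lambda]_x f x.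

(* The value at n = 0 is the neutral element delta 0. *)
Definition conv_pow (op : pplus R -> pplus R -> pplus R) lambda (n : nat) :=
  iter n (op lambda) (delta 0%:nng).

(* [gc_congr] says that [op] descends to measures modulo [measure_eq]; it is a
   consequence of [gc_continuous] applied to constant sequences. *)
Record generalized_convolution (op : pplus R -> pplus R -> pplus R) : Prop := {
  gc_congr : forall l1 l2 n1 n2 : pplus R,
    l1 ≡μ l2 -> n1 ≡μ n2 -> op l1 n1 ≡μ op l2 n2 ;
  gc_assoc : forall l1 l2 l3 : pplus R, op l1 (op l2 l3) ≡μ op (op l1 l2) l3 ;
  gc_comm : forall l1 l2 : pplus R, op l1 l2 ≡μ op l2 l1 ;
  gc_unit : forall l : pplus R, op l (delta 0%:nng) ≡μ l ;
  gc_mix : forall (p : {i01 R}) (l1 l2 l : pplus R),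
    op (mix p l1 l2) l ≡μ mix p (op l1 l) (op l2 l) ;
  gc_dilation : forall (a : {nonneg R}) (l1 l2 : pplus R),
    dilation a (op l1 l2) ≡μ op (dilation a l1) (dilation a l2) ;
  gc_continuous : forall (l n : nat -> pplus R) (l0 n0 : pplus R),
    weak_cvg l l0 -> weak_cvg n n0 ->
    weak_cvg (fun k => op (l k) (n k)) (op l0 n0) ;
  gc_limit : exists (c : nat -> {nonneg R}) (nu : pplus R),
    [/\ forall n, 0 < (c n)%:num, ~ nu ≡μ delta 0%:nng &
        weak_cvg (fun n => dilation (c n) (conv_pow op (delta 1%:nng) n)) nu] }.

Definition m0 : {measure set (measurableTypeR R) -> \bar R} :=
  measure_add \d_(0 : measurableTypeR R)
    (mrestr lebesgue_measure (measurable_itv `[0, +oo[)).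

(* Functions on [0, +oo[ are total functions whose values at negative numbers
   are never used. *)
Definition transform (phi : R -> R) lambda (t : R) : R :=
  \int[lambda]_(x in `[0, +oo[) phi (t * x).

Record is_probability_kernel (op : pplus R -> pplus R -> pplus R)
    (phi : R -> R) : Prop := {
  pk_borel : measurable_fun (`[0, +oo[ : set R) phi ;
  pk_one : phi 0 = 1 ;
  pk_bound : forall t, 0 <= t -> `|phi t| <= 1 ;
  pk_separates : forall l1 l2 : pplus R,
    (forall t, 0 <= t -> transform phi l1 t = transform phi l2 t) ->
    l1 ≡μ l2 ;
  pk_weak_cvg : forall (l : nat -> pplus R) (l0 : pplus R),
    weak_cvg l l0 <->
    (forall g : R -> R, m0.-integrable `[0, +oo[ (EFin \o g) ->
       (fun n => \int[m0]_(t in `[0, +oo[) (transform phi (l n) t * g t)) @ \oo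
         --> \int[m0]_(t in `[0, +oo[) (transform phi l0 t * g t)) ;
  pk_mult : forall (x y : {nonneg R}) (t : R), 0 <= t ->
    phi (x%:num * t) * phi (y%:num * t) =
    \int[op (delta x) (delta y)]_(s in `[0, +oo[) phi (s * t) }.

Definition monotonic_gc (op : pplus R -> pplus R -> pplus R) : Prop :=
  forall x y : {nonneg R},
    op (delta x) (delta y) `[Num.max x%:num y%:num, +oo[%classic = 1%E.

(* The joint law of independent X and x <> y is the product measure, so the
   left-hand side is P{X > x <> y}. *)
Definition lack_of_memory (op : pplus R -> pplus R -> pplus R)
    (nu : pplus R) : Prop :=
  ~ nu ≡μ delta 0%:nng /\
  forall x y : {nonneg R},
    ((nu \x op (delta x) (delta y)) [set z : R * R | (z.2 < z.1)%R] =
     nu `]x%:num, +oo[%classic * nu `]y%:num, +oo[%classic)%E.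

(* Agreement is required at continuity points only. *)
Definition is_cdf_of (F : R -> R) (mu : probability (measurableTypeR R) R)
    : Prop :=
  forall t : R,
    {for t, continuous (fun s : R => fine (mu `]-oo, s]%classic))} ->
    F t = fine (mu `]-oo, t]%classic).

End pplus_operations.

(* Main.v *)
(* Write p(t) = nu(]t, oo[) and q(t) = nu([t, oo[). Each condition is equivalent
   to the existence of a probability nu on ]0, oo[ with phi(t) = p(t) whenever
   nu has no atom at t; for condition 3) nu is the law of 1/X, X being distributed
   according to mu. Passing to one-sided limits of generic arguments, p and q
   inherit the product formula of phi with respect to the laws of x <> y, and at
   t = 1 the formula for p is the lack of memory property. Limits at 0 and at
   infinity are idempotent by dominated convergence, and phi is not constant on
   ]0, oo[ since transforms separate points, so they are 1 and 0.

   What remains is that phi, which is arbitrary at the countably many atoms of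
   nu, is nonincreasing; in fact phi = p or phi = q on ]0, oo[. Let M_r be the law
   of 1 <> r, which lives on [1, oo[ since the convolution is monotonic, and let
   m(r) = M_r({1}). A jump of p forces m(r) --> 1 as r --> 0, while
   p(rt) >= m(r) as long as p(t) > 0, so p has a first zero, say 1. Letting t
   increase to 1 in p(t)(p(rt) - m(r)) = \int_]1, oo[ p(st) M_r(ds) gives
   m(r) = q(r). If phi(1) <> 0, the formula for phi at t = 1 reads phi(r) = m(r),
   hence phi = q. If phi(1) = 0 < q(1), then phi - p = O(p) near 1, which the
   product formulas propagate to phi = p. If q(1) = 0, then p has no jump. *)
From HB Require Import structures.
Require Import Defs.
From mathcomp Require Import all_boot all_order all_algebra.
From mathcomp Require Import interval_inference.
From mathcomp Require Import all_classical all_reals all_analysis.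
From mathcomp Require Import measurable_realfun giry ring lra.
Import Order.TTheory GRing.Theory Num.Theory.
Import numFieldNormedType.Exports.
Local Open Scope classical_set_scope.
Local Open Scope ring_scope.

Set Implicit Arguments.
Unset Strict Implicit.
Unset Printing Implicit Defensive.

(** * Integrals of bounded functions *)

(** The common bound 1 survives rescaling of the argument and dominates every integrand when limits
    are taken. *)
Definition unit_bounded {R : realType} (f : R -> R) : Prop :=
  measurable_fun [set: R] f /\ forall x, `|f x| <= 1.

Section bounded_integrals.
Context {R : realType} (P : probability (measurableTypeR R) R).
Implicit Types (A D : set (measurableTypeR R)) (f g : R -> R).

Definition mass A : R := fine (P A).

Lemma massK A : measurable A -> (mass A)%:E = P A.
Proof. by move=> mA; rewrite fineK// fin_num_measure. Qed.

Lemma mass_ge0 A : 0 <= mass A.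
Proof. exact: fine_ge0. Qed.

Lemma mass_le1 A : measurable A -> mass A <= 1.
Proof. by move=> mA; rewrite -lee_fin massK// probability_le1. Qed.

Lemma mass_setT : mass setT = 1.
Proof. by rewrite /mass probability_setT. Qed.

Lemma le_mass A D : measurable A -> measurable D -> A `<=` D ->
  mass A <= mass D.
Proof. by move=> mA mD AD; rewrite -lee_fin !massK// le_measure ?inE. Qed.

Lemma mass_setU A D : measurable A -> measurable D -> A `&` D = set0 ->
  mass (A `|` D) = mass A + mass D.
Proof.
move=> mA mD AD; apply: EFin_inj; rewrite EFinD !massK ?measureU//.
exact: measurableU.
Qed.

Lemma bounded_integrable {A f} (C : R) : measurable A ->
  measurable_fun setT f -> (forall x, `|f x| <= C) ->
  P.-integrable A (EFin \o f).
Proof.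
move=> mA mf fC; apply: measurable_bounded_integrable => //.
- by rewrite (le_lt_trans (probability_le1 P mA))// ltry.
- exact: measurable_funS mf.
- exists C; split; first exact: num_real.
  by move=> M CM x _; exact: le_trans (fC x) (ltW CM).
Qed.

Lemma integrable_scale_indic D A (c : R) : measurable D -> measurable A ->
  P.-integrable D (EFin \o (fun x => c * \1_A x)).
Proof.
move=> mD mA; apply: (@bounded_integrable _ _ `|c|) => // [|x].
  by apply: measurable_funM => //; exact: measurable_indic.
by rewrite normrM ler_piMr// /indic; case: (_ \in _); rewrite ?normr0 ?normr1.
Qed.

Lemma Rintegral_scale_indic D A (c : R) : measurable D -> measurable A ->
  \int[P]_(x in D) (c * \1_A x) = c * mass (A `&` D).
Proof.
move=> mD mA; rewrite RintegralZl ?/Rintegral ?integral_indic//.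
move: (integrable_scale_indic 1 mD mA); apply: eq_integrable => // x _ /=.
by rewrite mul1r.
Qed.

(** The constant [e] needs no mass factor, since a probability gives [D] mass at most 1. *)
Lemma Rintegral_le_simple {D f} (C e a b : R) A B : measurable D ->
  measurable A -> measurable B -> measurable_fun setT f ->
  (forall x, `|f x| <= C) -> 0 <= e -> 0 <= a -> 0 <= b ->
  (forall x, D x -> f x <= e + a * \1_A x + b * \1_B x) ->
  \int[P]_(x in D) f x <= e + a * mass A + b * mass B.
Proof.
move=> mD mA mB mf fC e0 a0 b0 fe.
have intI (c : R) E : 0 <= c -> measurable E ->
    \int[P]_(x in D) (c * \1_E x) <= c * mass E.
  move=> c0 mE; rewrite Rintegral_scale_indic// ler_wpM2l// le_mass//.
  exact: measurableI.
have inte : P.-integrable D (EFin \o cst e).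
  exact: (@bounded_integrable _ _ `|e|).
have intea : P.-integrable D (EFin \o (fun x => e + a * \1_A x)).
  rewrite (_ : _ \o _ = (EFin \o cst e) \+ (EFin \o (fun x => a * \1_A x)))//.
  by apply: integrableD => //; exact: integrable_scale_indic.
have inteb : P.-integrable D (EFin \o (fun x => e + a * \1_A x + b * \1_B x)).
  rewrite (_ : _ \o _ = (EFin \o (fun x => e + a * \1_A x)) \+
     (EFin \o (fun x => b * \1_B x)))//.
  by apply: integrableD => //; exact: integrable_scale_indic.
apply: (le_trans (le_Rintegral mD (bounded_integrable mD mf fC) inteb fe)).
rewrite RintegralD//; last exact: integrable_scale_indic.
rewrite RintegralD//; last exact: integrable_scale_indic.
by rewrite !lerD ?intI// Rintegral_cst// ler_piMr// mass_le1.
Qed.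

Lemma Rintegral_le_cst {D f} (C b : R) B : measurable D -> measurable B ->
  measurable_fun setT f -> (forall x, `|f x| <= C) -> 0 <= b ->
  (forall x, D x -> f x <= b * \1_B x) ->
  \int[P]_(x in D) f x <= b * mass B.
Proof.
move=> mD mB mf fC b0 fb.
have := Rintegral_le_simple mD measurable0 mB mf fC (lexx 0) (lexx 0) b0.
rewrite mul0r !add0r; apply => // x Dx.
by rewrite mul0r !add0r fb.
Qed.

Lemma Rintegral_ge_cst {D f} (C a : R) A : measurable D -> measurable A ->
  A `<=` D -> measurable_fun setT f -> (forall x, `|f x| <= C) ->
  (forall x, D x -> 0 <= f x) -> (forall x, A x -> a <= f x) ->
  a * mass A <= \int[P]_(x in D) f x.
Proof.
move=> mD mA AD mf fC f0 fa.
rewrite -[X in mass X](setIidl AD) -Rintegral_scale_indic//.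
apply: le_Rintegral => //; first exact: integrable_scale_indic.
  exact: bounded_integrable fC.
move=> x Dx; rewrite /indic; have [/set_mem/fa|_] := boolP (x \in A).
  by rewrite mulr1.
by rewrite mulr0 f0.
Qed.

Lemma unit_comp_scale f (t : R) : unit_bounded f ->
  unit_bounded (fun s => f (s * t)).
Proof.
case=> mf f1; split; last by move=> x; exact: f1.
apply: (measurableT_comp mf); exact: measurable_funM.
Qed.

Lemma Rintegral_mass1 A f : measurable A -> P A = 1%E -> unit_bounded f ->
  \int[P]_x f x = \int[P]_(x in A) f x.
Proof.
move=> mA PA [mf f1].
have PN : P (~` A) = 0%E by rewrite probability_setC// PA subee.
rewrite -(setUv A) Rintegral_setU//; last 3 first.
- exact: measurableC.
- by rewrite setUv; exact: (@bounded_integrable _ _ 1).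
- by apply/disj_setPS; rewrite setICr.
rewrite [X in _ + X](_ : _ = 0) ?addr0//.
rewrite /Rintegral null_set_integral//; first exact: measurableC.
by apply/measurable_EFinP; exact: measurable_funS mf.
Qed.

Lemma Rintegral_split1 f : P `[1, +oo[%classic = 1%E -> unit_bounded f ->
  \int[P]_x f x = f 1 * mass [set 1] + \int[P]_(x in `]1, +oo[) f x.
Proof.
move=> P1 uf; have [mf f1] := uf.
have m1 : measurable [set (1 : R)] by exact: measurable_set1.
rewrite (@Rintegral_mass1 `[1, +oo[%classic)//.
rewrite -(@setU1itv _ _ _ 1 false) ?bnd_simp// Rintegral_setU//; last 2 first.
- by apply: (@bounded_integrable _ _ 1) => //; exact: measurableU.
- by apply/disj_setPS => x [/= ->]; rewrite in_itv/= ltxx.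
congr (_ + _); rewrite -Rintegral_cst//.
by apply: eq_Rintegral => x; rewrite inE => ->.
Qed.

Lemma bounded_cvg_Rintegral A (f_ : (R -> R)^nat) f : measurable A ->
  (forall n, unit_bounded (f_ n)) -> unit_bounded f ->
  (forall x, A x -> f_ n x @[n --> \oo] --> f x) ->
  \int[P]_(x in A) f_ n x @[n --> \oo] --> \int[P]_(x in A) f x.
Proof.
move=> mA uf_ uf ff; apply: fine_cvg.
rewrite fineK; last first.
  by apply: integrable_fin_num => //; exact: bounded_integrable uf.1 uf.2.
apply: (@dominated_cvg _ _ _ P A mA (fun n => EFin \o f_ n) (EFin \o f) (cst 1%E)).
- by move=> n; apply/measurable_EFinP; exact: measurable_funS (uf_ n).1.
- by move=> x Ax; apply: cvg_EFin; [exact: nearW|exact: ff].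
- by [].
- by apply: (@bounded_integrable _ (cst 1) 1) => // x; rewrite normr1.
- by move=> n x _; rewrite lee_fin; exact: (uf_ n).2.
Qed.

Lemma countable_null A : countable A -> (forall x, A x -> mass [set x] = 0) ->
  P A = 0%E.
Proof.
move=> cA A0; have mA : measurable A.
  by apply: countable_measurable => // t; exact: measurable_set1.
apply/negligibleP => //; have [g ginj] := countable_injP _ cA.
(* The fibres of the injection [g] on [A] have at most one point, so [A] is a countable union of
   null sets. *)
pose F n := [set x | A x /\ g x = n].
apply: (@negligibleS _ _ _ _ (\bigcup_n F n)).
  by move=> x Ax; exists (g x).
apply: negligible_bigcup => n.
have [->|/set0P[x [Ax gx]]] := eqVneq (F n) set0; first exact: negligible_set0.
exists [set x]; split; first exact: measurable_set1.
  by apply/eqP; rewrite -fine_eq0 ?fin_num_measure//; exact/eqP/A0.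
by move=> y [Ay gy]; apply: ginj; rewrite ?inE// gx.
Qed.

Lemma mass_gt1 : P `[1, +oo[%classic = 1%E ->
  mass `]1, +oo[%classic = 1 - mass [set 1].
Proof.
move=> P1; have : mass `[1, +oo[%classic = 1 by rewrite /mass P1.
rewrite -(@setU1itv _ _ _ 1 false) ?bnd_simp// mass_setU//; first lra.
by apply/seteqP; split => // x [/= ->]; rewrite in_itv/= ltxx.
Qed.

End bounded_integrals.

(** * One-sided tails and multiplicative functions *)

Section one_sided_tails.
Context {R : realType}.
Implicit Types (p q : R -> R).

(* [p] and [q] behave like [t |-> nu ]t, +oo[] and [t |-> nu [t, +oo[] for a
   probability measure [nu]: the same nonincreasing function up to a countable
   set, normalized to be right-, resp. left-continuous. *)
Record tails p q : Prop := {
  tails_ge0 : forall t, 0 <= p t ;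
  tails_le1 : forall t, q t <= 1 ;
  tails_le : forall t, p t <= q t ;
  tails_lt : forall t u, t < u -> q u <= p t ;
  tails_right : forall t e, 0 < e -> exists2 u, t < u & p t - e < q u ;
  tails_left : forall t e, 0 < e -> exists2 u, u < t & p u < q t + e ;
  tails_eq : forall a b, a < b -> exists2 y, a < y < b & p y = q y }.

Context {p q : R -> R} (pq : tails p q).

Lemma tails_p_le t u : t <= u -> p u <= p t.
Proof.
rewrite le_eqVlt => /predU1P[->//|tu].
exact: le_trans (tails_le pq u) (tails_lt pq tu).
Qed.

Lemma tails_q_le t u : t <= u -> q u <= q t.
Proof.
rewrite le_eqVlt => /predU1P[->//|tu].
exact: le_trans (tails_lt pq tu) (tails_le pq t).
Qed.

Lemma tails_q_ge0 t : 0 <= q t.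
Proof. exact: le_trans (tails_ge0 pq t) (tails_le pq t). Qed.

Lemma tails_p_le1 t : p t <= 1.
Proof. exact: le_trans (tails_le pq t) (tails_le1 pq t). Qed.

Lemma tails_p_unit : unit_bounded p.
Proof.
split=> [|x]; last by rewrite ger0_norm ?(tails_ge0 pq)// tails_p_le1.
by apply: nonincreasing_measurable => // x y; exact: tails_p_le.
Qed.

Lemma tails_q_unit : unit_bounded q.
Proof.
split=> [|x]; last by rewrite ger0_norm ?tails_q_ge0// (tails_le1 pq).
by apply: nonincreasing_measurable => // x y; exact: tails_q_le.
Qed.

Lemma tails_scale (c : R) : 0 < c -> tails (fun t => p (c * t)) (fun t => q (c * t)).
Proof.
move=> c0.
have cK t : c * (t / c) = t by rewrite mulrC divfK// gt_eqF.
split.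
- by move=> t; exact: (tails_ge0 pq).
- by move=> t; exact: (tails_le1 pq).
- by move=> t; exact: (tails_le pq).
- by move=> t u tu; apply: (tails_lt pq); rewrite ltr_pM2l.
- move=> t e /(tails_right pq (c * t))[u tu ptu].
  by exists (u / c); rewrite ?cK// ltr_pdivlMr// mulrC.
- move=> t e /(tails_left pq (c * t))[u tu ptu].
  by exists (u / c); rewrite ?cK// ltr_pdivrMr// mulrC.
- move=> a b ab; have [|y yab py] := @tails_eq _ _ pq (c * a) (c * b).
    by rewrite ltr_pM2l.
  by exists (y / c); rewrite ?cK// ltr_pdivlMr// ltr_pdivrMr// ![_ * c]mulrC.
Qed.

End one_sided_tails.

(** * The product formula under monotonicity *)

Section multiplicative_functions.
Context {R : realType} (M : R -> probability (measurableTypeR R) R).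

(** [M r] stands for the law of 1 <> r; up to order, the pairs [t], [r * t] are all pairs of
    positive arguments. *)
Definition multiplicative (chi : R -> R) : Prop :=
  forall r t, 0 < r <= 1 -> 0 < t ->
    chi t * chi (r * t) = \int[M r]_s chi (s * t).

Hypothesis M1 : forall r, 0 < r <= 1 -> M r `[1, +oo[%classic = 1%E.

Let m r := mass (M r) [set 1].

(** The atom of [M r] at 1 contributes [m r * chi t]; moved to the left, it leaves only arguments
    beyond [t]. This is how monotonicity enters the later estimates. *)
Lemma multiplicative_split chi r t : unit_bounded chi -> multiplicative chi ->
  0 < r <= 1 -> 0 < t ->
  chi t * (chi (r * t) - m r) = \int[M r]_(s in `]1, +oo[) chi (s * t).
Proof.
move=> uchi mchi r01 t0; rewrite mulrBr mchi//.
rewrite (Rintegral_split1 (M1 r01)) ?mul1r; last exact: unit_comp_scale.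
by rewrite addrAC subrr add0r.
Qed.

Lemma multiplicative_scale chi c : 0 < c -> multiplicative chi ->
  multiplicative (fun t => chi (c * t)).
Proof.
move=> c0 mchi r t r01 t0; rewrite mulrCA mchi//; last exact: mulr_gt0.
by apply: eq_Rintegral => s _; rewrite mulrCA.
Qed.

Context {p q : R -> R} (pq : tails p q).
Hypotheses (mp : multiplicative p) (mq : multiplicative q).

(** For [s > 1] the integrand [q (s * x)] is at most [p x], so [q x * (q (r * x) - m r) <= p x * (1
    - m r)]. At a jump [x] this forces [m r] to 1 when [q (r * x)] tends to 1. *)
Lemma jump_mass x r : 0 < x -> 0 < r <= 1 ->
  (q x - p x) * (1 - m r) <= q x * (1 - q (r * x)).
Proof.
move=> x0 r01.
have [mqx q1] := unit_comp_scale x (tails_q_unit pq).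
have := multiplicative_split (tails_q_unit pq) mq r01 x0.
have : \int[M r]_(s in `]1, +oo[) q (s * x) <= p x * mass (M r) `]1, +oo[%classic.
  apply: (@Rintegral_le_cst _ _ _ _ 1) => //; first exact: (tails_ge0 pq).
  move=> s s1; rewrite /indic mem_set// mulr1.
  move: s1; rewrite /= in_itv/= andbT => s1.
  by apply: (tails_lt pq); rewrite ltr_pMl.
rewrite (mass_gt1 (M1 r01)) -/(m r) => /[swap] <-; lra.
Qed.

(* With no zero of [p], the bound [m r <= p (r * t)] would hold for all [t],
   while a jump of [p] forces [m r] to tend to 1 at 0. *)
Lemma jump_vanish x : p 0 = 1 -> (forall e, 0 < e -> exists t, p t < e) ->
  0 < x -> p x < q x -> exists2 t, 0 < t & p t = 0.
Proof.
move=> p01 poo x0 pqx; apply: contrapT => pN0.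
have pgt0 t : 0 < t -> 0 < p t.
  move=> t0; rewrite lt_neqAle (tails_ge0 pq) andbT eq_sym.
  by apply/eqP => pt0; apply: pN0; exists t.
have mp_le r t : 0 < r <= 1 -> 0 < t -> m r <= p (r * t).
  move=> r01 t0.
  have := multiplicative_split (tails_p_unit pq) mp r01 t0.
  have : 0 <= \int[M r]_(s in `]1, +oo[) p (s * t).
    by apply: Rintegral_ge0 => s _; exact: (tails_ge0 pq).
  by move=> /[swap] <-; rewrite pmulr_rge0 ?pgt0// subr_ge0.
(* The argument [y / r] removes [r] from the right-hand side. *)
have m_le y r : 0 < y -> 0 < r <= 1 -> m r <= p y.
  move=> y0 /andP[r0 r1].
  have := mp_le r (y / r); rewrite r0 r1 [r * _]mulrC divfK ?gt_eqF//.
  by apply => //; exact: divr_gt0.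
have [t pt] := poo (2^-1) ltac:(lra).
have t0 : 0 < t.
  rewrite ltNge; apply/negP => /(tails_p_le pq); rewrite p01; lra.
(* With [m r < 1/2] and [q (r * x) > 1 - e], [jump_mass] bounds [3 * e * (1 - m r)] by [e], although
   it exceeds [3 * e / 2]. *)
pose e := (q x - p x) / 3.
have e0 : 0 < e by rewrite /e; lra.
have [u u0] := tails_right pq 0 e0; rewrite p01 => qu.
pose r := Num.min 1 (u / x).
have r01 : 0 < r <= 1 by rewrite /r lt_min ltr01 divr_gt0//= ge_min lexx.
have qrx : q u <= q (r * x).
  apply: (tails_q_le pq); rewrite -ler_pdivlMr//.
  by rewrite /r ge_min lexx orbT.
have := jump_mass x0 r01.
have := m_le t r t0 r01; have := tails_le1 pq x; have := tails_q_ge0 pq x.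
rewrite /e in qu e0; nra.
Qed.

End multiplicative_functions.

(** * Tails and atoms of a probability measure *)

Section tails_of_probability.
Context {R : realType} (P : probability (measurableTypeR R) R).

Lemma mass_itv_obnd a (b : itv_bound R) : (BRight a <= b)%O ->
  mass P [set` Interval (BLeft a) b] =
  mass P [set a] + mass P [set` Interval (BRight a) b].
Proof.
move=> ab; rewrite -(@setU1itv _ _ _ a false)// mass_setU//.
by apply/seteqP; split => // x [/= ->]; rewrite in_itv/= ltxx.
Qed.

Lemma atoms_countable : countable [set x | 0 < mass P [set x]].
Proof.
pose X : measurableTypeR R -> R := idfun.
have mX : measurable_fun setT X by exact: measurable_id.
pose hX := isMeasurableFun.Build _ _ (measurableTypeR R) R X mX.
pose Y : {mfun measurableTypeR R >-> R} := HB.pack X hX.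
exact: (@pmf_gt0_countable _ _ _ P Y).
Qed.

(** A nondegenerate interval has positive Lebesgue measure, a countable set has none. *)
Lemma countable_avoid (A : set R) a b : countable A -> a < b ->
  exists2 y, a < y < b & ~ A y.
Proof.
move=> cA ab; apply: contrapT => Ny.
have lab : lebesgue_measure (`]a, b[%classic : set R) = (b - a)%:E.
  by rewrite lebesgue_measure_itv/= lte_fin ab.
have : (lebesgue_measure (`]a, b[%classic : set R) <=
    lebesgue_measure (A : set R))%E.
  apply: le_measure; rewrite ?inE//.
    by apply: countable_measurable => // t; exact: measurable_set1.
  move=> y /=; rewrite in_itv/= => yab; apply: contrapT => Ay.
  by apply: Ny; exists y.
by rewrite lab countable_lebesgue_measure0// lee_fin leNgt subr_gt0 ab.
Qed.

Lemma mass_cvg_nondecreasing (F : (set (measurableTypeR R))^nat) :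
  (forall n, measurable (F n)) -> nondecreasing_seq F ->
  mass P (F n) @[n --> \oo] --> mass P (\bigcup_n F n).
Proof.
move=> mF ndF; have mU := bigcup_measurable (fun n _ => mF n).
apply: fine_cvg; rewrite massK//.
exact: nondecreasing_cvg_mu.
Qed.

Lemma mass_cvg_nonincreasing (F : (set (measurableTypeR R))^nat) :
  (forall n, measurable (F n)) -> nonincreasing_seq F ->
  mass P (F n) @[n --> \oo] --> mass P (\bigcap_n F n).
Proof.
move=> mF niF; have mI := bigcap_measurableType (fun n _ => mF n).
apply: fine_cvg; rewrite massK//.
apply: nonincreasing_cvg_mu => //.
by rewrite (le_lt_trans (probability_le1 P (mF 0%N)))// ltry.
Qed.

(** The one-sided approximations are continuity of the measure along increasing unions and
    decreasing intersections of half-lines; the last property holds off the countably many atoms. *)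
Lemma tails_probability :
  tails (fun t => mass P `]t, +oo[%classic) (fun t => mass P `[t, +oo[%classic).
Proof.
split.
- by move=> t; exact: mass_ge0.
- by move=> t; exact: mass_le1.
- by move=> t; apply: le_mass => //; apply: subset_itvr; rewrite bnd_simp.
- by move=> t u tu; apply: le_mass => //; apply: subset_itvr; rewrite bnd_simp.
- move=> t e e0.
  pose F n := `[(t + n.+1%:R^-1)%R, +oo[%classic : set (measurableTypeR R).
  have FU : \bigcup_n F n = `]t, +oo[%classic.
    apply/seteqP; split=> [x [n _]|x]; rewrite /F/= !in_itv/= !andbT.
      by apply: lt_le_trans; rewrite ltrDl.
    by move=> /ltr_add_invr[n tx]; exists n => //=; rewrite in_itv/= andbT ltW.
  have : mass P (F n) @[n --> \oo] --> mass P (\bigcup_n F n).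
    apply: mass_cvg_nondecreasing => [n|n k nk]; first exact: measurable_itv.
    apply/subsetPset.
    apply: subset_itvr.
    by rewrite bnd_simp lerD2l lef_pV2 ?posrE// ler_nat.
  rewrite FU => /cvgrPdist_lt/(_ _ e0)[N _ /(_ N (leqnn N))] /= FN.
  exists (t + N.+1%:R^-1); first by rewrite ltrDl.
  by rewrite ltrBlDl -ltrBlDr; exact: le_lt_trans (ler_norm _) FN.
- move=> t e e0.
  pose F n := `](t - n.+1%:R^-1)%R, +oo[%classic : set (measurableTypeR R).
  have FU : \bigcap_n F n = `[t, +oo[%classic.
    apply/seteqP; split=> [x|x]; rewrite /F/= !in_itv/= !andbT.
      move=> Fx; rewrite leNgt; apply/negP => /ltr_add_invr[n xt].
      have := Fx n I; rewrite /= in_itv/= andbT ltrBlDr => /(lt_trans xt).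
      by rewrite ltxx.
    move=> tx n _ /=; rewrite in_itv/= andbT; apply: lt_le_trans tx.
    by rewrite ltrBlDr ltrDl.
  have : mass P (F n) @[n --> \oo] --> mass P (\bigcap_n F n).
    apply: mass_cvg_nonincreasing => [n|n k nk]; first exact: measurable_itv.
    apply/subsetPset.
    apply: subset_itvr.
    by rewrite bnd_simp lerD2l lerN2 lef_pV2 ?posrE// ler_nat.
  rewrite FU => /cvgrPdist_lt/(_ _ e0)[N _ /(_ N (leqnn N))] /= FN.
  exists (t - N.+1%:R^-1); first by rewrite ltrBlDr ltrDl.
  by rewrite -ltrBlDl; apply: le_lt_trans FN; rewrite distrC ler_norm.
- move=> a b /(countable_avoid atoms_countable)[y yab Ny].
  exists y => //; rewrite mass_itv_obnd// (_ : mass P [set y] = 0) ?add0r//.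
  by apply/eqP; rewrite eq_le mass_ge0 andbT leNgt; apply/negP.
Qed.

Lemma tails_probability_jump t :
  mass P `[t, +oo[%classic - mass P `]t, +oo[%classic = mass P [set t].
Proof. by rewrite mass_itv_obnd// addrK. Qed.

Lemma mass_oo_small a e : 0 < e -> exists2 b, a < b & mass P `]a, b[%classic < e.
Proof.
move=> /(tails_right tails_probability a)[b ab h]; exists b => //.
move: h; rewrite ltrBlDr (_ : `]a, +oo[%classic = `]a, b[ `|` `[b, +oo[); last first.
  by rewrite -itv_bndbnd_setU ?bnd_simp// ltW.
rewrite mass_setU//; first by rewrite addrC ltrD2l.
apply/seteqP; split => // x [/=]; rewrite !in_itv/= andbT => /andP[_] xb.
by rewrite leNgt xb.
Qed.

End tails_of_probability.

(** * Multiplicative functions with prescribed generic values *)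

Section normalized_dichotomy.
Context {R : realType} (M : R -> probability (measurableTypeR R) R).
Hypothesis M1 : forall r, 0 < r <= 1 -> M r `[1, +oo[%classic = 1%E.
Context {p q : R -> R} (pq : tails p q).
Hypotheses (mp : multiplicative M p) (mq : multiplicative M q).
Hypotheses (p1 : p 1 = 0) (pgt0 : forall t, t < 1 -> 0 < p t).

Let m r := mass (M r) [set 1].

Lemma normalized_p0 t : 1 <= t -> p t = 0.
Proof.
by move=> /(tails_p_le pq) pt; apply/eqP; rewrite eq_le (tails_ge0 pq) -p1 pt.
Qed.

Lemma normalized_q0 t : 1 < t -> q t = 0.
Proof.
by move=> /(tails_lt pq) qt; apply/eqP; rewrite eq_le (tails_q_ge0 pq) -p1 qt.
Qed.

(** For [t < 1] divide [multiplicative_split] by [p t > 0]: the integrand [p (s * t)] is at most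
    [p t] and vanishes for [s >= t^-1], so [p (r * t) - m r] lies between 0 and the mass of []1,
    t^-1[]. As [t] increases to 1, this mass tends to 0 and [p (r * t)] to [q r]. *)
Lemma mass1E r : 0 < r <= 1 -> mass (M r) [set 1] = q r.
Proof.
move=> r01; have [r0 r1] := andP r01.
have pm t : 0 < t < 1 ->
    0 <= p (r * t) - m r <= mass (M r) `]1, t^-1[%classic.
  move=> /andP[t0 t1].
  have pt := pgt0 t1.
  have := multiplicative_split M1 (tails_p_unit pq) mp r01 t0.
  have [mf f1] := unit_comp_scale t (tails_p_unit pq).
  have : \int[M r]_(s in `]1, +oo[) p (s * t) <=
      p t * mass (M r) `]1, t^-1[%classic.
    apply: (@Rintegral_le_cst _ _ _ _ 1) => //; first exact: ltW.
    move=> s /=; rewrite in_itv/= andbT => s1; rewrite /indic.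
    have [_|] := boolP (s \in _).
      by rewrite mulr1; apply: (tails_p_le pq); rewrite ler_pMl// ltW.
    rewrite mem_setE in_itv/= s1/= -leNgt mulr0 => ts.
    by rewrite normalized_p0// -ler_pdivrMr// mul1r.
  have : 0 <= \int[M r]_(s in `]1, +oo[) p (s * t).
    by apply: Rintegral_ge0 => s _; exact: (tails_ge0 pq).
  move=> i0 ile ieq; move: i0 ile; rewrite -ieq.
  by rewrite pmulr_rge0// ler_pM2l// => -> ->.
apply/eqP; rewrite eq_le; apply/andP; split.
  apply/ler_addgt0Pr => e /(tails_left pq r)[u ur pu].
  (* Only the position of [t] matters here; 1/2 keeps it positive, as [u] may be negative. *)
  have [t /andP[urt t1] _] := @tails_eq _ _ _ pq (Num.max (2^-1) (u / r)) 1
    ltac:(by rewrite gt_max ltr_pdivrMr// mul1r ur invf_lt1// ltr1n).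
  move: urt; rewrite gt_max => /andP[t0 urt].
  have := pm t; rewrite t1 (lt_trans _ t0) ?invr_gt0// => /(_ isT)/andP[+ _].
  rewrite subr_ge0 => /le_trans; apply; apply: le_trans (ltW pu).
  by apply: (tails_p_le pq); rewrite -ler_pdivrMl// mulrC ltW.
apply/ler_addgt0Pr => e /(mass_oo_small (M r) 1)[b b1 Mb].
have b0 : 0 < b by lra.
have := pm b^-1; rewrite invr_gt0 b0 invf_lt1// b1 invrK => /(_ isT)/andP[_].
rewrite lerBlDl => prb; apply: (le_trans _ (le_trans prb _)); last first.
  by rewrite lerD2l ltW.
by apply: (tails_lt pq); rewrite gtr_pMr// invf_lt1.
Qed.

Lemma normalized_split chi r t : unit_bounded chi -> multiplicative M chi ->
  0 < r <= 1 -> 0 < t ->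
  chi t * (chi (r * t) - q r) = \int[M r]_(s in `]1, +oo[) chi (s * t).
Proof.
by move=> uchi mchi r01 t0; rewrite -(mass1E r01); exact: multiplicative_split.
Qed.

(** Subtract [normalized_split] for [p] from that for [chi], at [t = y] and [r = x / y]: the terms
    in [q (x / y)] cancel because [chi y = p y]. *)
Lemma normalized_diff chi x y : unit_bounded chi -> multiplicative M chi ->
  0 < x -> x <= y -> chi y = p y ->
  (chi x - p x) * p y =
  \int[M (x / y)]_(s in `]1, +oo[) (chi (s * y) - p (s * y)).
Proof.
move=> uchi mchi x0 xy chiy.
have y0 : 0 < y by exact: lt_le_trans xy.
have r01 : 0 < x / y <= 1 by rewrite divr_gt0//= ler_pdivrMr// mul1r.
have [mf f1] := unit_comp_scale y (tails_p_unit pq).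
have [mg g1] := unit_comp_scale y uchi.
rewrite RintegralB//; first last.
- exact: (@bounded_integrable _ _ _ _ 1).
- exact: (@bounded_integrable _ _ _ _ 1).
rewrite -!normalized_split//; last exact: (tails_p_unit pq).
by rewrite divfK ?gt_eqF// chiy; lra.
Qed.

(* Let [y] increase to 1 in [normalized_diff]: the right-hand side is at most
   [C * \int p (s * y) = C * p y * (p x - q (x / y))]. *)
Lemma normalized_eq chi C y0 x : unit_bounded chi -> multiplicative M chi ->
  (forall y, 0 < y -> p y = q y -> chi y = p y) ->
  (forall y, 1 <= y -> chi y = 0) -> 0 <= C ->
  y0 < 1 -> (forall y, y0 < y < 1 -> `|chi y - p y| <= C * p y) ->
  0 < x < 1 -> chi x = p x.
Proof.
move=> uchi mchi chip chi0 C0 y01 chiC /andP[x0 x1].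
apply/eqP; rewrite -subr_eq0 -normr_le0; apply/ler_addgt0Pr => e e0.
have C1 : 0 < C + 1 by lra.
(* Taking [y > x / u] below keeps [x / y] under [u], so that [p x - q (x / y) < e / (C + 1)]; the
   added 1 covers [C = 0]. *)
have [u xu qu] := tails_right pq x (divr_gt0 e0 C1).
have u0 : 0 < u by exact: lt_trans xu.
have [y /andP[y1 y2] py] := @tails_eq _ _ _ pq
  (Num.max y0 (Num.max x (x / u))) 1
  ltac:(by rewrite !gt_max y01 x1 ltr_pdivrMr// mul1r).
move: y1; rewrite !gt_max => /and3P[y0y xy xuy].
have yp : 0 < y by exact: lt_trans xy.
have r01 : 0 < x / y <= 1 by rewrite divr_gt0//= ler_pdivrMr// mul1r ltW.
have [mf f1] := unit_comp_scale y (tails_p_unit pq).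
have [mg g1] := unit_comp_scale y uchi.
have intp := @bounded_integrable _ (M (x / y)) _ _ _
  (measurable_itv `]1, +oo[) mf f1.
have intd : (M (x / y)).-integrable `]1, +oo[
    (EFin \o (fun s => chi (s * y) - p (s * y))).
  apply: (@bounded_integrable _ _ _ _ 2) => //; first exact: measurable_funB.
  move=> s; have := f1 s; have := g1 s.
  by have := ler_normB (chi (s * y)) (p (s * y)); lra.
have := normalized_diff uchi mchi x0 (ltW xy) (chip _ yp py).
have : `|\int[M (x / y)]_(s in `]1, +oo[) (chi (s * y) - p (s * y))| <=
    \int[M (x / y)]_(s in `]1, +oo[) (C * p (s * y)).
  apply: le_trans (le_normr_Rintegral _ intd) _ => //.
  apply: le_Rintegral => //.
  - exact: (integrable_norm intd).
  - apply: (@bounded_integrable _ _ _ _ C) => //; first exact: measurable_funM.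
    by move=> s; rewrite normrM ger0_norm// ler_piMr.
  move=> s /=; rewrite in_itv/= andbT => s1.
  have sy : y0 < s * y by rewrite (lt_trans y0y)// ltr_pMl.
  have [sy1|sy1] := ltP (s * y) 1; first by rewrite chiC// sy.
  by rewrite chi0// normalized_p0// subr0 normr0 mulr0.
rewrite RintegralZl// -normalized_split//; last exact: (tails_p_unit pq).
rewrite divfK ?gt_eqF// => /[swap] <-.
rewrite normrM (ger0_norm (tails_ge0 pq y)) mulrCA mulrC ler_pM2l ?pgt0//.
move=> /le_trans; apply; rewrite add0r.
have quy : q u <= q (x / y).
  by apply: (tails_q_le pq); rewrite ler_pdivrMr// mulrC -ler_pdivrMr// ltW.
have : C * (e / (C + 1)) <= e.
  by rewrite mulrCA ger_pMr// ler_pdivrMr// mul1r; lra.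
by apply: le_trans; rewrite ler_wpM2l//; lra.
Qed.

(** Use [normalized_split] for [q] with [t] near 1 and [r] slightly above [z]: [q (r * t)] is at
    most about [q z], [q r] is about [p z], and on []1, r / z]] the integrand is at least about
    [q t]. Dividing by [q t] leaves the jump at [z]. *)
Lemma mass_right_small z e : 0 < z < 1 -> 0 < e ->
  exists2 u, z < u <= 1 & forall r, z < r < u ->
    mass (M r) `]1, r / z]%classic <= q z - p z + e.
Proof.
(* One third each for [q (r * t)], for [q r], and for the factor [1 - e1] of the mass. *)
move=> /andP[z0 z1] e0; pose e1 := e / 3.
have e10 : 0 < e1 by rewrite /e1; lra.
have [u1 u1z pu1] := tails_left pq z e10.
have [u2 zu2 qu2] := tails_right pq z e10.
(* Genericity of [t] turns [p t - e1 * q t < q u3] into [(1 - e1) * q t < q u3]. *)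
have [t /andP[u1t t1] pt] := @tails_eq _ _ _ pq (Num.max (2^-1) (u1 / z)) 1
  ltac:(by rewrite gt_max ltr_pdivrMr// mul1r u1z invf_lt1// ltr1n).
move: u1t; rewrite gt_max => /andP[t2 u1t].
have t0 : 0 < t by lra.
have qt0 : 0 < q t by rewrite -pt pgt0.
have [u3 tu3 qu3] := tails_right pq t (mulr_gt0 e10 qt0).
exists (Num.min 1 (Num.min u2 (u3 * z / t))).
  rewrite !lt_min z1 zu2 ge_min lexx/= andbT.
  by rewrite ltr_pdivlMr// mulrC ltr_pM2r.
move=> r; rewrite !lt_min => /and4P[zr r1 ru2 ru3].
have r0 : 0 < r by exact: lt_trans zr.
have r01 : 0 < r <= 1 by rewrite r0 ltW.
have [mf f1] := unit_comp_scale t (tails_q_unit pq).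
have := normalized_split (tails_q_unit pq) mq r01 t0.
have : q (r / z * t) * mass (M r) `]1, r / z]%classic <=
    \int[M r]_(s in `]1, +oo[) q (s * t).
  apply: (@Rintegral_ge_cst _ _ _ _ 1) => //.
  - by apply: subset_itvl; rewrite bnd_simp.
  - by move=> s _; exact: (tails_q_ge0 pq).
  move=> s /=; rewrite in_itv/= => /andP[_ srz].
  by apply: (tails_q_le pq); rewrite ler_wpM2r// ltW.
move=> /[swap] <-.
have q1 : q u3 <= q (r / z * t).
  apply: (tails_q_le pq).
  by rewrite mulrAC ler_pdivrMr// -ler_pdivlMr// ltW.
have q2 : q (r * t) <= p u1.
  apply: (tails_lt pq); rewrite -ltr_pdivrMr//.
  apply: lt_trans zr.
  by rewrite ltr_pdivrMr// mulrC -ltr_pdivrMr.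
have q3 : q u2 <= q r by apply: (tails_q_le pq); exact: ltW.
have M0 := mass_ge0 (M r) `]1, (r / z)].
have Ml := @mass_le1 _ (M r) `]1, (r / z)]%classic (measurable_itv _).
set mu := mass _ _ in M0 Ml *.
move=> h.
have h1 : (1 - e1) * q t * mu <= q (r / z * t) * mu.
  by rewrite ler_wpM2r//; lra.
have h2 : q t * (q (r * t) - q r) <= q t * (q z - p z + 2 * e1).
  by rewrite ler_pM2l//; lra.
have : q t * ((1 - e1) * mu) <= q t * (q z - p z + 2 * e1) by lra.
rewrite ler_pM2l// => h3.
have : e1 * mu <= e1 by rewrite ler_piMr// ltW.
by move: h3; rewrite /e1; lra.
Qed.

(* If [q 1 = 0], a jump at [d] forces points [c] near 1 where [p] drops by more
   than half ([normalized_eq] for [chi = q]). Comparing at [y] just below such a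
   [c] the jump [j] at [d] with the masses of [M (d / y)], which put at most about
   [j] on ]1, 1/y] and at most the jump at [d / c] on [c / y], the jump at
   [d / c] is not small: impossible, as [d / c] decreases to [d]. *)
Lemma normalized_no_jump d : q 1 = 0 -> 0 < d < 1 -> q d = p d.
Proof.
move=> q10 d01; have [d0 d1] := andP d01.
apply/eqP; rewrite -subr_eq0; apply: contraT => jN0.
have j0 : 0 < q d - p d by rewrite lt_neqAle eq_sym jN0 subr_ge0 (tails_le pq).
(* With this choice the estimates end in [8 * e * (p c + J) <= 3 * e * J + 9 * e * p c], which
   contradicts [p c < J]. *)
pose e := (q d - p d) / 8.
have e0 : 0 < e by rewrite /e; lra.
have [u0 /andP[du0 _] hu0] := mass_right_small d01 e0.
have [u1 du1 qu1] := tails_right pq d e0.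
have u0p : 0 < u0 by exact: lt_trans du0.
have u1p : 0 < u1 by exact: lt_trans du1.
pose y0 := Num.max d (Num.max (d / u0) (d / u1)).
have y01 : y0 < 1.
  by rewrite !gt_max d1 !ltr_pdivrMr// !mul1r du0.
(* If [q - p <= p] held on all of []y0, 1[], [normalized_eq] with [chi = q] and [C = 1] would
   exclude the jump at [d]. *)
have [c /andP[y0c c1] pc] : exists2 c, y0 < c < 1 & p c < q c - p c.
  apply: contrapT => Nc; move/negP: jN0; apply; rewrite subr_eq0; apply/eqP.
  apply: (@normalized_eq q 1 y0) => //.
  - exact: (tails_q_unit pq).
  - by move=> y; rewrite le_eqVlt => /predU1P[<-//|]; exact: normalized_q0.
  move=> y yy; rewrite mul1r ger0_norm ?subr_ge0 ?(tails_le pq)//.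
  by rewrite leNgt; apply/negP => ?; apply: Nc; exists y.
move: (y0c); rewrite !gt_max => /and3P[dc cu0 cu1].
have c0 : 0 < c by exact: lt_trans dc.
have dc01 : 0 < d / c < 1 by rewrite divr_gt0//= ltr_pdivrMr// mul1r.
have [u2 /andP[dcu2 _] hu2] := mass_right_small dc01 e0.
have u2p : 0 < u2 by apply: lt_trans dcu2; rewrite divr_gt0.
pose J := q c - p c.
have J0 : 0 < J by apply: le_lt_trans pc; exact: (tails_ge0 pq).
have [u3 u3c pu3] := tails_left pq c (mulr_gt0 e0 J0).
have [y /andP[y1 yc] py] := @tails_eq _ _ _ pq
  (Num.max y0 (Num.max u3 (d / u2))) c
  ltac:(by rewrite gt_max y0c/= gt_max u3c/= ltr_pdivrMr// mulrC -ltr_pdivrMr).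
move: y1; rewrite gt_max => /andP[y0y]; rewrite gt_max => /andP[u3y u2y].
move: (y0y); rewrite !gt_max => /and3P[dy yu0 yu1].
have yp : 0 < y by exact: lt_trans dy.
(* The interval in [hu2] ends at [(d / y) / (d / c) = c / y]. As [d < d / c < u1], the jump at
   [d / c] is at most [e], and [hu2] adds another [e]. *)
have Mc : mass (M (d / y)) [set c / y] <= 2 * e.
  have := hu2 (d / y).
  rewrite ltr_pM2l// ltf_pV2// yc/= ltr_pdivrMr// mulrC -ltr_pdivrMr// u2y.
  move=> /(_ isT) h.
  have qdc : q (d / c) <= p d.
    by apply: (tails_lt pq); rewrite ltr_pdivlMr// gtr_pMr.
  have pdc : q u1 <= p (d / c).
    by apply: (tails_lt pq); rewrite ltr_pdivrMr// mulrC -ltr_pdivrMr.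
  have : mass (M (d / y)) [set c / y] <=
      mass (M (d / y)) `]1, (d / y) / (d / c)]%classic.
    apply: le_mass => //.
    move=> s /= ->; rewrite in_itv/=.
    have -> : d / y / (d / c) = c / y by rewrite invf_div; field; lra.
    by rewrite lexx andbT ltr_pdivlMr// mul1r.
  by lra.
have My : mass (M (d / y)) `]1, y^-1]%classic <= q d - p d + e.
  have := hu0 (d / y); rewrite [d / y / d]mulrAC divff ?gt_eqF// mul1r; apply.
  rewrite ltr_pdivlMr// gtr_pMr// (lt_trans yc)//=.
  by rewrite ltr_pdivrMr// mulrC -ltr_pdivrMr.
have := normalized_diff (tails_q_unit pq) mq d0 (ltW dy) (esym py).
have [mf f1] := unit_comp_scale y (tails_p_unit pq).
have [mg g1] := unit_comp_scale y (tails_q_unit pq).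
(* For [s * y < c] the difference is at most [p y - q c < e * J]; at [c] it equals [J]; above [c] it
   is at most [p c], and it vanishes beyond 1. *)
have : \int[M (d / y)]_(s in `]1, +oo[) (q (s * y) - p (s * y)) <=
    e * J + J * mass (M (d / y)) [set c / y] +
    p c * mass (M (d / y)) `]1, y^-1]%classic.
  apply: (@Rintegral_le_simple _ _ _ _ 2) => //.
  - exact: measurable_funB.
  - move=> s; have := f1 s; have := g1 s.
    by have := ler_normB (q (s * y)) (p (s * y)); lra.
  - by rewrite mulr_ge0// ltW.
  - exact: ltW.
  - exact: (tails_ge0 pq).
  move=> s /=; rewrite in_itv/= andbT => s1; rewrite /indic.
  have ysy : y < s * y by rewrite ltr_pMl.
  have pc0 := tails_ge0 pq c.
  have eJ : 0 <= e * J by rewrite mulr_ge0// ltW.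
  have [sc|sc|sc] := ltgtP (s * y) c.
  - have h1 := tails_lt pq ysy; have h2 := tails_lt pq sc.
    have h3 : p y <= p u3 by apply: (tails_p_le pq); exact: ltW.
    have : 0 <= J * (s \in [set c / y])%:R by rewrite mulr_ge0// ltW.
    have : 0 <= p c * (s \in `]1, y^-1]%classic)%:R by rewrite mulr_ge0.
    by lra.
  - have h1 := tails_lt pq sc.
    have : 0 <= J * (s \in [set c / y])%:R by rewrite mulr_ge0// ltW.
    have p0 := tails_ge0 pq (s * y).
    have [|] := boolP (s \in `]1, y^-1]%classic); first by rewrite mulr1; lra.
    rewrite mem_setE in_itv/= s1/= -ltNge mulr0 => ys.
    rewrite normalized_q0; first by lra.
    by rewrite -ltr_pdivrMr// mul1r.
  - rewrite mem_set; last by rewrite -sc mulfK// gt_eqF.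
    rewrite sc mulr1 -/J.
    have : 0 <= p c * (s \in `]1, y^-1]%classic)%:R by rewrite mulr_ge0.
    by lra.
move=> /[swap] <- h.
have pyc : q c <= p y by exact: (tails_lt pq).
have h1 : (q d - p d) * (p c + J) <= (q d - p d) * p y.
  by rewrite ler_pM2l// /J; lra.
have h2 : J * mass (M (d / y)) [set c / y] <= J * (2 * e) by rewrite ler_pM2l.
have h3 : p c * mass (M (d / y)) `]1, y^-1]%classic <= p c * (q d - p d + e).
  by rewrite ler_wpM2l// (tails_ge0 pq).
have h4 : p c * e <= J * e by rewrite ler_pM2r// ltW.
have h5 : 0 < J * e by rewrite mulr_gt0.
have h6 : q d - p d = 8 * e by rewrite /e; lra.
by rewrite h6 in h h1 h3; nra.
Qed.

Lemma normalized_dichotomy phi : unit_bounded phi -> multiplicative M phi ->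
  (forall y, 0 < y -> p y = q y -> phi y = p y) ->
  (forall t, 0 < t -> phi t = p t) \/ (forall t, 0 < t -> phi t = q t).
Proof.
move=> uphi mphi phip.
have phi0 t : 1 < t -> phi t = 0.
  move=> t1; rewrite phip ?normalized_p0 ?normalized_q0//; first exact: ltW.
    exact: lt_trans t1.
  exact: ltW.
have [phi1|phi1] := eqVneq (phi 1) 0; last first.
  right=> t t0; have [t1|t1] := leP t 1; last by rewrite phi0// normalized_q0.
  (* At argument 1 the integral only sees points beyond 1, where [phi] is 0, so
     [phi 1 * (phi t - q t) = 0]. *)
  have := @normalized_split phi t 1 uphi mphi; rewrite t0 t1 ltr01.
  move=> /(_ isT isT).
  rewrite (@eq_Rintegral _ _ _ _ _ (cst 0)); last first.
    by move=> s; rewrite inE/= in_itv/= andbT mulr1 => /phi0.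
  rewrite Rintegral_cst// mul0r mulr1 => /eqP.
  by rewrite mulf_eq0 (negbTE phi1) subr_eq0 => /eqP.
left=> t t0; have [t1|t1|->] := ltgtP t 1; last by rewrite phi1 p1.
- have t01 : 0 < t < 1 by rewrite t0.
  have [q1|q1] := eqVneq (q 1) 0.
    by apply: phip => //; rewrite normalized_no_jump.
  have q10 : 0 < q 1 by rewrite lt_neqAle eq_sym q1 (tails_q_ge0 pq).
  (* The constant works because [|phi y - p y| <= 2] always and [p y >= q 1] for [y < 1]. *)
  apply: (@normalized_eq phi (2 / q 1) 0) => //.
  - by move=> y; rewrite le_eqVlt => /predU1P[<-//|]; exact: phi0.
  - by rewrite divr_ge0// ltW.
  move=> y /andP[y0 y1].
  have : 2 <= 2 / q 1 * p y.
    by rewrite mulrAC ler_pdivlMr// ler_pM2l//; exact: (tails_lt pq).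
  have := uphi.2 y; have := (tails_p_unit pq).2 y.
  by have := ler_normB (phi y) (p y); lra.
- by rewrite phi0// normalized_p0// ltW.
Qed.

End normalized_dichotomy.

(** * Rescaling the first zero to 1 *)

Section dichotomy.
Context {R : realType} (M : R -> probability (measurableTypeR R) R).
Hypothesis M1 : forall r, 0 < r <= 1 -> M r `[1, +oo[%classic = 1%E.
Context {p q : R -> R} (pq : tails p q).

(** The infimum of the zeros is itself a zero by right continuity, and it is positive because
    [p 0 = 1]. *)
Lemma tails_first_zero t : p 0 = 1 -> p t = 0 ->
  exists2 T, 0 < T & p T = 0 /\ forall u, u < T -> 0 < p u.
Proof.
move=> p01 pt0.
pose S := [set u | p u = 0].
have S0 u : S u -> 0 <= u.
  move=> Su; rewrite leNgt; apply/negP => /ltW/(tails_p_le pq).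
  by rewrite p01 Su ler10.
have hS : has_inf S by split; [exists t | exists 0 => u; exact: S0].
have pS : p (inf S) = 0.
  apply/eqP; apply: contraT => pN0.
  have pi0 : 0 < p (inf S) by rewrite lt_neqAle eq_sym pN0 (tails_ge0 pq).
  have [u Su] := tails_right pq (inf S) pi0; rewrite subrr => qu.
  have [v Sv vu] := inf_lt hS.1 Su.
  by have := tails_lt pq vu; rewrite Sv leNgt qu.
exists (inf S).
  rewrite lt_neqAle lb_le_inf ?andbT//; last exact: hS.1.
  by apply: contra_eq_neq pS => <-; rewrite p01 oner_neq0.
split=> // u uS; rewrite lt_neqAle (tails_ge0 pq) andbT eq_sym.
apply/eqP => pu0; move: uS; rewrite ltNge => /negP; apply.
by apply: ge_inf => //; exact: hS.2.
Qed.

(** Without a jump every positive argument is generic. With one, [p] has a first zero [T], and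
    [t |-> T * t] reduces to the normalized case. *)
Lemma multiplicative_dichotomy phi :
  multiplicative M p -> multiplicative M q ->
  p 0 = 1 -> (forall e, 0 < e -> exists t, p t < e) ->
  unit_bounded phi -> multiplicative M phi ->
  (forall y, 0 < y -> p y = q y -> phi y = p y) ->
  (forall t, 0 < t -> phi t = p t) \/ (forall t, 0 < t -> phi t = q t).
Proof.
move=> mp mq p01 poo uphi mphi phip.
have [nojump|/existsNP[x /not_implyP[x0 /eqP pqx]]] :=
    pselect (forall x, 0 < x -> p x = q x).
  by left=> t t0; rewrite phip// nojump.
have pltq : p x < q x by rewrite lt_neqAle pqx (tails_le pq).
have [t _ pt0] := jump_vanish M1 pq mp mq p01 poo x0 pltq.
have [T T0 [pT0 pgt0]] := tails_first_zero p01 pt0.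
have [|||||h|h] := @normalized_dichotomy _ M M1 _ _ (tails_scale pq T0)
    (multiplicative_scale T0 mp) (multiplicative_scale T0 mq) _ _
    (fun t => phi (T * t)).
- by rewrite mulr1.
- by move=> u u1; apply: pgt0; rewrite gtr_pMr.
- have -> : (fun t => phi (T * t)) = (fun t => phi (t * T)).
    by apply/funext => u; rewrite mulrC.
  exact: unit_comp_scale.
- exact: multiplicative_scale.
- by move=> y y0; apply: phip; exact: mulr_gt0.
- by left=> u u0; have := h (u / T); rewrite [T * _]mulrC divfK ?gt_eqF//; apply;
    exact: divr_gt0.
- by right=> u u0; have := h (u / T); rewrite [T * _]mulrC divfK ?gt_eqF//; apply;
    exact: divr_gt0.
Qed.

End dichotomy.

(** * Transfer of the product formula *)

Section transfer.
Context {R : realType} {p q : R -> R} (pq : tails p q).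

Lemma tails_right_cvg t (u_ : R^nat) : (forall n, t < u_ n) ->
  u_ n @[n --> \oo] --> t -> p (u_ n) @[n --> \oo] --> p t.
Proof.
move=> tu ut; apply/cvgrPdist_lt => e /(tails_right pq t)[v tv pv].
have : \forall n \near \oo, u_ n < v by exact: (cvgr_lt t).
apply: filterS => n unv.
rewrite ger0_norm ?subr_ge0; last by apply: (tails_p_le pq); exact: ltW.
by have := tails_lt pq unv; lra.
Qed.

Lemma tails_left_cvg t (u_ : R^nat) : (forall n, u_ n < t) ->
  u_ n @[n --> \oo] --> t -> q (u_ n) @[n --> \oo] --> q t.
Proof.
move=> tu ut; apply/cvgrPdist_lt => e /(tails_left pq t)[v tv pv].
have : \forall n \near \oo, v < u_ n by exact: (cvgr_gt t).
apply: filterS => n unv; rewrite distrC.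
rewrite ger0_norm ?subr_ge0; last by apply: (tails_q_le pq); exact: ltW.
by have := tails_lt pq unv; lra.
Qed.

Hypothesis cpq : countable [set t | p t != q t].
Variables (P : probability (measurableTypeR R) R) (phi : R -> R) (x y : R).
Hypotheses (P0 : P `]0, +oo[%classic = 1%E) (x0 : 0 < x) (y0 : 0 < y).
Hypotheses (uphi : unit_bounded phi).
Hypothesis phip : forall t, 0 < t -> p t = q t -> phi t = p t.
Hypothesis phiM : forall t, 0 < t ->
  phi (x * t) * phi (y * t) = \int[P]_s phi (s * t).

(** Arguments where the formula for [phi] cannot be read off from [p]: a factor sits at a jump, or
    an atom of [P] sends the integrand to one. Each is a jump divided by [x], [y] or an atom, so
    they are countably many. *)
Let bad : set R := [set t | 0 < t /\
  [\/ p (x * t) != q (x * t), p (y * t) != q (y * t) |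
      exists s, [/\ 0 < s, 0 < mass P [set s] & p (s * t) != q (s * t)]]].

Let bad_countable : countable bad.
Proof.
have cU (A C : set R) : countable A -> countable C -> countable (A `|` C).
  move=> cA cC; rewrite -bigcup2E; apply: bigcup_countable => // n _.
  by case: n => [//|[//|n]]; exact: countable0.
pose B : set R := [set x] `|` [set y] `|` [set s | 0 < mass P [set s]].
have cB : countable B.
  by apply: (cU _ _ _ (atoms_countable P)); apply: cU; exact: countable1.
apply: (@sub_countable _ _ _ ((fun z => z.1 / z.2) @`
    ([set t | p t != q t] `*` B))); last first.
  by apply: sub_countable (card_image_le _ _) _; exact: countableX.
apply: subset_card_le => t [t0 [px|py|[s [s0 Ps ps]]]].
- exists (x * t, x); first by split => //; left; left.
  by rewrite /= mulrAC divff ?mul1r ?gt_eqF.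
- exists (y * t, y); first by split => //; left; right.
  by rewrite /= mulrAC divff ?mul1r ?gt_eqF.
- exists (s * t, s); first by split => //; right.
  by rewrite /= mulrAC divff ?mul1r ?gt_eqF.
Qed.

(** For a good [t] both factors are generic, and on [s > 0] the integrands of [chi] and [phi] differ
    at most on a countable set free of atoms of [P]. *)
Let good_eq chi t : unit_bounded chi ->
  (forall u, 0 < u -> p u = q u -> chi u = p u) -> 0 < t -> ~ bad t ->
  chi (x * t) * chi (y * t) = \int[P]_(s in `]0, +oo[) chi (s * t).
Proof.
move=> uchi chip t0 Nbad.
have pqx : p (x * t) = q (x * t).
  by apply: contrapT => /eqP h; apply: Nbad; split => //; apply: Or31.
have pqy : p (y * t) = q (y * t).
  by apply: contrapT => /eqP h; apply: Nbad; split => //; apply: Or32.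
have xt : 0 < x * t by exact: mulr_gt0.
have yt : 0 < y * t by exact: mulr_gt0.
rewrite (chip _ xt pqx) (chip _ yt pqy) -(phip xt pqx) -(phip yt pqy) phiM//.
have [mphi _] := unit_comp_scale t uphi; have [mchi _] := unit_comp_scale t uchi.
rewrite (@Rintegral_mass1 _ _ `]0, +oo[%classic)//; last exact: unit_comp_scale.
congr fine; apply: ae_eq_integral => //.
- by apply/measurable_EFinP; exact: measurable_funS mphi.
- by apply/measurable_EFinP; exact: measurable_funS mchi.
pose N : set R := [set s | 0 < s /\ p (s * t) != q (s * t)].
have cN : countable N.
  apply: (@sub_countable _ _ _ ((fun z => z / t) @` [set t | p t != q t])).
    apply: subset_card_le => s [s0 ps]; exists (s * t) => //=.
    by rewrite mulfK// gt_eqF.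
  exact: sub_countable (card_image_le _ _) cpq.
exists N; split.
- by apply: countable_measurable => // s; exact: measurable_set1.
- apply: countable_null => // s [s0 ps].
  apply/eqP; rewrite eq_le mass_ge0 andbT leNgt; apply/negP => Ps.
  by apply: Nbad; split => //; apply: Or33; exists s.
move=> s /= /not_implyP[]; rewrite in_itv/= andbT => s0 hs; split => //.
apply/eqP => ps; apply: hs; congr EFin.
have st : 0 < s * t by exact: mulr_gt0.
by rewrite (phip st ps) (chip _ st ps).
Qed.

(** Dominated convergence along good arguments reaches any [t], good or bad. *)
Let good_limit chi t (u_ : R^nat) : unit_bounded chi ->
  (forall u, 0 < u -> p u = q u -> chi u = p u) ->
  (forall n, 0 < u_ n /\ ~ bad (u_ n)) ->
  (forall s, 0 < s -> chi (s * u_ n) @[n --> \oo] --> chi (s * t)) ->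
  chi (x * t) * chi (y * t) = \int[P]_s chi (s * t).
Proof.
move=> uchi chip u_good cvgs.
rewrite (@Rintegral_mass1 _ _ `]0, +oo[%classic)//; last exact: unit_comp_scale.
have lim1 : chi (x * u_ n) * chi (y * u_ n) @[n --> \oo] -->
    chi (x * t) * chi (y * t) by apply: cvgM; exact: cvgs.
have uE : (fun n => chi (x * u_ n) * chi (y * u_ n)) =
    (fun n => \int[P]_(s in `]0, +oo[) chi (s * u_ n)).
  by apply/funext => n; have [] := u_good n; exact: good_eq.
rewrite uE in lim1; apply: (cvg_unique _ lim1) => //.
apply: (@bounded_cvg_Rintegral _ P _ (fun n s => chi (s * u_ n))
  (fun s => chi (s * t))) => // [n||s /=].
- exact: unit_comp_scale.
- exact: unit_comp_scale.
- by rewrite in_itv/= andbT => /cvgs.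
Qed.

Let good_between a b : a < b -> exists2 u, a < u < b & ~ bad u.
Proof. exact: countable_avoid bad_countable. Qed.

Lemma tails_transfer_right t : 0 < t ->
  p (x * t) * p (y * t) = \int[P]_s p (s * t).
Proof.
move=> t0.
have /choice[u_ hu] n : exists u, t < u < t + n.+1%:R^-1 /\ ~ bad u.
  have [|u ? ?] := @good_between t (t + n.+1%:R^-1); first by rewrite ltrDl.
  by exists u.
have tu n : t < u_ n by have [/andP[]] := hu n.
have ut : u_ n @[n --> \oo] --> t.
  apply: (@squeeze_cvgr _ _ _ _ (cst t) (fun n => t + n.+1%:R^-1)).
  - by apply: nearW => n; have [/andP[/ltW -> /ltW ->]] := hu n.
  - exact: cvg_cst.
  rewrite -[X in _ --> X]addr0; apply: cvgD; first exact: cvg_cst.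
  exact: cvg_harmonic.
apply: (@good_limit p t u_ (tails_p_unit pq)) => // [n|s s0].
  by split; [exact: lt_trans (tu n)|have [] := hu n].
apply: tails_right_cvg => [n|]; first by rewrite ltr_pM2l.
by apply: cvgM => //; exact: cvg_cst.
Qed.

Lemma tails_transfer_left t : 0 < t ->
  q (x * t) * q (y * t) = \int[P]_s q (s * t).
Proof.
move=> t0.
(* The lower end is 0 for [n = 0] and never negative, so every [u_ n] is positive. *)
have /choice[u_ hu] n : exists u, t * (1 - n.+1%:R^-1) < u < t /\ ~ bad u.
  have [|u ? ?] := @good_between (t * (1 - n.+1%:R^-1)) t.
    by rewrite gtr_pMr// ltrBlDr ltrDl.
  by exists u.
have tu n : u_ n < t by have [/andP[]] := hu n.
have ut : u_ n @[n --> \oo] --> t.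
  apply: (@squeeze_cvgr _ _ _ _ (fun n => t * (1 - n.+1%:R^-1)) (cst t)).
  - by apply: nearW => n; have [/andP[/ltW -> /ltW ->]] := hu n.
  - rewrite -[X in _ --> X]mulr1; apply: cvgM; first exact: cvg_cst.
    rewrite -[X in _ --> X]subr0; apply: cvgB; first exact: cvg_cst.
    exact: cvg_harmonic.
  exact: cvg_cst.
apply: (@good_limit q t u_ (tails_q_unit pq)) => // [n|s s0].
  split; last by have [] := hu n.
  have [/andP[+ _] _] := hu n; apply: le_lt_trans.
  apply: mulr_ge0; first exact: ltW.
  by rewrite subr_ge0 invf_le1// ler1n.
apply: tails_left_cvg => [n|]; first by rewrite ltr_pM2l.
by apply: cvgM => //; exact: cvg_cst.
Qed.

End transfer.

(** * Continuity points, reciprocals and idempotent limits *)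

Section probability_on_half_line.
Context {R : realType}.
Implicit Type P : probability (measurableTypeR R) R.

Lemma mass_eq1 P A B C : measurable A -> measurable B -> measurable C ->
  P B = 1%E -> (forall x, B x -> A x <-> C x) -> mass P A = mass P C.
Proof.
move=> mA mB mC PB AC.
have PN D : measurable D -> mass P D = mass P (D `&` B).
  move=> mD; rewrite -{1}(setUIDK D B) mass_setU; last 3 first.
  - exact: measurableI.
  - exact: measurableD.
  - by rewrite setDE setIACA setICr setI0.
  suff : mass P (D `\` B) <= 0.
    by have := mass_ge0 P (D `\` B); lra.
  have -> : 0 = mass P (~` B) by rewrite /mass probability_setC// PB subee.
  by apply: le_mass; [exact: measurableD|exact: measurableC|move=> x []].
rewrite (PN A)// (PN C)//; congr (mass P _).
by apply/seteqP; split => x [h Bx]; split => //; apply/(AC x Bx).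
Qed.

Lemma mass_NyitvE P t : mass P `]-oo, t]%classic = 1 - mass P `]t, +oo[%classic.
Proof.
apply/eqP; rewrite eq_sym subr_eq -mass_setU//.
  by rewrite itv_setU_setT mass_setT.
exact/disj_set2P/disjoint_rays.
Qed.

(** Translates the continuity points of [is_cdf_of] into the points without atom of [tail_law]. *)
Lemma cdf_continuousP P t :
  {for t, continuous (fun s => fine (P `]-oo, s]%classic))} <->
  mass P [set t] = 0.
Proof.
have pq := tails_probability P.
have -> : (fun s => fine (P `]-oo, s]%classic)) =
    (fun s => 1 - mass P `]s, +oo[%classic).
  by apply/funext => s; rewrite -mass_NyitvE.
rewrite -tails_probability_jump; split.
  move=> ct; apply/eqP; apply: contraT => jN0.
  have j0 : 0 < mass P `[t, +oo[%classic - mass P `]t, +oo[%classic.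
    by rewrite lt_neqAle eq_sym jN0 subr_ge0 (tails_le pq).
  move/cvgrPdist_lt : ct => /(_ _ j0) /nbhs_ballP[e /= e0].
  move=> /(_ (t - e / 2)); rewrite /ball/= => h.
  have : `|t - (t - e / 2)| < e.
    by rewrite opprB addrC subrK ger0_norm; lra.
  move=> /h.
  have te : t - e / 2 < t by lra.
  have := tails_lt pq te; have := tails_le pq t.
  set a := mass P `[t, +oo[%classic; set b := mass P `]t, +oo[%classic.
  set c := mass P `](t - e / 2), +oo[%classic => ba ac.
  have -> : 1 - b - (1 - c) = c - b by lra.
  by rewrite ger0_norm; lra.
move=> /subr0_eq pqt; apply/cvgrPdist_lt => e e0.
have [u tu pu] := tails_right pq t e0.
have [v vt pv] := tails_left pq t e0.
have : \forall s \near t, s \in `]v, u[.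
  by apply: near_in_itvoo; rewrite in_itv/= vt.
apply: filterS => s; rewrite in_itv/= => /andP[vs su].
have := tails_lt pq su; have := tails_p_le pq (ltW vs); rewrite /= in pu pv *.
rewrite pqt in pv.
by move=> h1 h2; rewrite ltr_norml; apply/andP; split; lra.
Qed.

(** A real power is measurable on the whole line and equals [x^-1] for [x > 0]; other values do not
    matter for laws on []0, +oo[]. *)
Definition reciprocal (x : measurableTypeR R) : measurableTypeR R := x `^ (-1).

Lemma measurable_reciprocal : measurable_fun setT reciprocal.
Proof. exact: measurable_powR. Qed.

HB.instance Definition _ :=
  isMeasurableFun.Build _ _ _ _ reciprocal measurable_reciprocal.

(** For [x > 0], [t < x^-1] means [x < t^-1], so an open tail of the reciprocal is the complement of
    a closed one. *)
Lemma reciprocal_law P : P `]0, +oo[%classic = 1%E ->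
  exists Q : probability (measurableTypeR R) R,
  [/\ Q `]0, +oo[%classic = 1%E,
      forall t, 0 < t -> mass Q [set t] = mass P [set t^-1] &
      forall t, 0 < t -> mass Q `]t, +oo[%classic = 1 - mass P `[t^-1, +oo[%classic].
Proof.
move=> P0.
pose Q : probability (measurableTypeR R) R := distribution P reciprocal.
have QE A : mass Q A = mass P (reciprocal @^-1` A) by [].
have mQ A : measurable A -> measurable (reciprocal @^-1` A).
  by move=> mA; rewrite -[X in measurable X]setTI; exact: measurable_reciprocal.
have Pge0 : `]0, +oo[%classic `<=` [set x : R | 0 < x].
  by move=> x /=; rewrite in_itv/= andbT.
have recE x : 0 < x -> reciprocal x = x^-1.
  by move=> x0; rewrite /reciprocal powR_inv1// ltW.
exists Q; split.
- apply/eqP; rewrite eq_le probability_le1//= -P0 /Q /distribution/= /pushforward.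
  apply: le_measure; rewrite ?inE//; first exact: mQ.
  by move=> x /Pge0 x0 /=; rewrite in_itv/= recE// invr_gt0 x0.
- move=> t t0; rewrite QE; apply: (mass_eq1 (B := `]0, +oo[%classic)) => //.
  move=> x /Pge0 x0; rewrite /= recE//.
  by split=> [<-|->]; rewrite invrK.
- move=> t t0; rewrite QE.
  have -> : 1 - mass P `[t^-1, +oo[%classic = mass P `]-oo, t^-1[%classic.
    apply/eqP; rewrite subr_eq -mass_setU//.
      by rewrite itv_setU_setT mass_setT.
    exact/disj_set2P/disjoint_rays.
  apply: (mass_eq1 (B := `]0, +oo[%classic)) => //; first exact: mQ.
  move=> x /Pge0 x0; rewrite /= !in_itv/= andbT recE//.
  have -> : (t < x^-1) = (x < t^-1).
    by rewrite -[t in LHS]invrK ltf_pV2 ?posrE ?invr_gt0.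
  by [].
Qed.

(** The limit does not depend on the factor [s], so the integrals tend to [l] by dominated
    convergence, while the products tend to [l * l]. *)
Lemma limit_idempotent P chi (u_ : R^nat) (l : R) :
  P `]0, +oo[%classic = 1%E -> unit_bounded chi -> (forall n, 0 < u_ n) ->
  (forall n, chi (u_ n) * chi (u_ n) = \int[P]_s chi (s * u_ n)) ->
  (forall s, 0 < s -> chi (s * u_ n) @[n --> \oo] --> l) -> l * l = l.
Proof.
move=> P0 uchi u0 chiM cvgs.
have cvg1 : chi (u_ n) @[n --> \oo] --> l.
  by have := cvgs 1 ltr01; under eq_fun do rewrite mul1r.
have l1 : `|l| <= 1.
  have cvgnl : `|chi (u_ n)| @[n --> \oo] --> `|l| by exact: cvg_norm.
  rewrite -(cvg_lim _ cvgnl)//.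
  by apply: limr_le; [apply/cvg_ex; exists `|l|%R|apply: nearW => n; exact: uchi.2].
have cvgl : chi (u_ n) * chi (u_ n) @[n --> \oo] --> l * l by exact: cvgM.
have uE : (fun n => chi (u_ n) * chi (u_ n)) =
    (fun n => \int[P]_(s in `]0, +oo[) chi (s * u_ n)).
  apply/funext => n; rewrite chiM.
  by rewrite (@Rintegral_mass1 _ _ `]0, +oo[%classic)//; exact: unit_comp_scale.
rewrite uE in cvgl.
have cvgr : \int[P]_(s in `]0, +oo[) chi (s * u_ n) @[n --> \oo] -->
    \int[P]_(s in `]0, +oo[) (cst l s).
  apply: (@bounded_cvg_Rintegral _ P _ (fun n s => chi (s * u_ n)) (cst l)) => //.
  - by move=> n; exact: unit_comp_scale.
  - by move=> s /=; rewrite in_itv/= andbT => /cvgs.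
have cstE : \int[P]_(s in `]0, +oo[) (cst l s) = l.
  rewrite Rintegral_cst// (_ : fine _ = 1) ?mulr1//.
  by have /(congr1 fine) := P0.
rewrite cstE in cvgr; exact: (cvg_unique _ cvgl cvgr).
Qed.

End probability_on_half_line.

(** * Existence of laws *)

Section laws.
Context {R : realType}.

(** The law is the Lebesgue-Stieltjes measure of the right-continuous version [F] of [f]. At a jump
    [f] may lie anywhere between its one-sided limits, hence two bounds rather than an equality. *)
Lemma law_of_nondecreasing (f : R -> R) : nondecreasing f ->
  (forall t, 0 <= f t <= 1) -> (exists t, f t = 0) ->
  f t @[t --> +oo] --> (1 : R) ->
  exists nu : probability (measurableTypeR R) R, forall t,
    mass nu `]t, +oo[%classic <= 1 - f t <= mass nu `[t, +oo[%classic.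
Proof.
move=> ndf f01 [t0 ft0] foo.
pose F t := inf (f @` `]t, +oo[%classic).
have Fne t : (f @` `]t, +oo[%classic) !=set0.
  by exists (f (t + 1)), (t + 1) => //=; rewrite in_itv/= andbT ltrDl.
have Flb t : has_lbound (f @` `]t, +oo[%classic).
  by exists 0 => _ [u _ <-]; have /andP[] := f01 u.
have F_le t u : t < u -> F t <= f u.
  move=> tu; apply: ge_inf => //; exists u => //=.
  by rewrite in_itv/= andbT.
have le_F t : f t <= F t.
  apply: lb_le_inf => // _ [u /= + <-]; rewrite in_itv/= andbT => tu.
  by apply: ndf; exact: ltW.
have F_lt t e : 0 < e -> exists2 u, t < u & f u < F t + e.
  move=> e0; have [_ [u /= + <-] fu] := inf_adherent e0 (conj (Fne t) (Flb t)).
  by rewrite in_itv/= andbT => tu; exists u.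
have ndF : nondecreasing F.
  move=> x y; rewrite le_eqVlt => /predU1P[->//|xy].
  exact: le_trans (F_le _ _ xy) (le_F y).
have rcF : right_continuous F.
  move=> t; apply/cvgrPdist_lt => e /(F_lt t)[u tu fu].
  near=> s.
  have ts : t < s by near: s; exact: nbhs_right_gt.
  have su : s < u by near: s; exact: nbhs_right_lt.
  rewrite distrC ger0_norm ?subr_ge0 ?ndF ?ltW//.
  by have := F_le _ _ su; lra.
have FNy : F @ -oo --> (0 : R).
  apply/cvgrPdist_lt => e e0; near=> s.
  have st : s < t0 by near: s; apply: nbhs_ninfty_lt; exact: num_real.
  have Fs : F s <= 0 by rewrite -ft0; exact: F_le.
  have := le_F s; have /andP[f0 _] := f01 s.
  by move=> h; rewrite (_ : F s = 0) ?subrr ?normr0//; lra.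
have Fy : F @ +oo --> (1 : R).
  apply: (@squeeze_cvgr _ _ _ _ f (cst 1)) => //; last exact: cvg_cst.
  apply: nearW => s; rewrite le_F/=.
  have s1 : s < s + 1 by rewrite ltrDl.
  by apply: le_trans (F_le _ _ s1) _; have /andP[] := f01 (s + 1).
pose Fc := isCumulative.Build R _ R F ndF rcF.
pose Fb := isCumulativeBounded.Build R 0 1 F FNy Fy.
pose G : cumulativeBounded (0 : R) (1 : R) := HB.pack F Fc Fb.
pose nu : probability (measurableTypeR R) R := lebesgue_stieltjes_measure G.
have pE t : mass nu `]t, +oo[%classic = 1 - F t.
  have : mass nu `]-oo, t]%classic = F t.
    by have /(congr1 fine) := cdf_lebesgue_stieltjes_id G t.
  by rewrite mass_NyitvE; lra.
exists nu => t; have pq := tails_probability nu; apply/andP; split.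
  by rewrite pE lerD2l lerN2.
(* For [u < t], [F u <= f t] bounds [1 - f t] by the open tail at [u], which [tails_left] brings
   within [e] of the closed tail at [t]. *)
apply/ler_addgt0Pr => e /(tails_left pq t)[u ut]; rewrite /= pE => h.
by have := F_le _ _ ut; lra.
Unshelve. all: by end_near. Qed.

(** The product measure is computed with the second coordinate outside: the section at [b] is then
    the half-line []b, +oo[]. *)
Lemma product_tail (nu P : probability (measurableTypeR R) R) :
  ((nu \x P) [set z : R * R | (z.2 < z.1)%R] =
   (\int[P]_b (mass nu `]b, +oo[%classic))%:E)%E.
Proof.
have mlt : measurable [set z : measurableTypeR R * measurableTypeR R | (z.2 < z.1)%R].
  rewrite -[X in measurable X]setTI.
  have := @measurable_fun_ltr _ (measurableTypeR R * measurableTypeR R)%type R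
    setT snd fst measurable_snd measurable_fst measurableT [set true].
  rewrite preimage_true; exact.
have mu2 X : measurable X -> (nu \x P)%E X = (nu \x^ P)%E X.
  by apply: product_measure_unique => A B mA mB; exact: product_measure2E.
rewrite mu2// /product_measure2 /=.
rewrite /Rintegral fineK; last first.
  apply: integrable_fin_num => //.
  have [mq q1] := tails_p_unit (tails_probability nu).
  exact: bounded_integrable mq q1.
apply: eq_integral => b _ /=.
rewrite massK//; congr (nu _); apply/seteqP; split => a.
  by rewrite /ysection/= inE/= in_itv/= andbT.
by rewrite /ysection/= inE/= in_itv/= andbT.
Qed.

End laws.

(** * Kernels of monotonic convolutions *)

Lemma Rintegral_delta (R : realType) (P : pplus R) (z : {nonneg R}) (f : R -> R) :
  P ≡μ delta z -> unit_bounded f -> \int[P]_s f s = f z%:num.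
Proof.
move=> Pz [mf _]; rewrite /Rintegral.
rewrite (eq_measure_integral (delta z)); last by move=> A mA _; exact: Pz.
by rewrite /= integral_dirac// ?diracT ?mul1e//; exact/measurable_EFinP.
Qed.

(* [phi] is left arbitrary at the countably many atoms of [nu]. *)
Definition tail_law (R : realType) (phi : R -> R)
    (nu : probability (measurableTypeR R) R) : Prop :=
  nu `]0, +oo[%classic = 1%E /\
  forall t, 0 < t -> mass nu [set t] = 0 ->
    phi t = mass nu `]t, +oo[%classic.

Section kernel.
Context {R : realType} {op : pplus R -> pplus R -> pplus R} {phi : R -> R}.
Hypotheses (hop : generalized_convolution op) (hmono : monotonic_gc op).
Hypothesis hphi : is_probability_kernel op phi.

(** Values of [phi] at negative numbers are arbitrary; replacing them by 0 gives measurability and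
    the bound on the whole line. *)
Let phi0 : R -> R := phi \_ `[0, +oo[.

Let phi0E t : 0 <= t -> phi0 t = phi t.
Proof. by move=> t0; rewrite /phi0 patchE mem_set//= in_itv/= t0. Qed.

Let phi0_unit : unit_bounded phi0.
Proof.
split.
  have := (@measurable_restrictT _ _ (measurableTypeR R) R `[0, +oo[%classic phi
    (measurable_itv _)).1 (pk_borel hphi).
  exact.
move=> t; rewrite /phi0 patchE; case: ifPn => [|_]; last by rewrite normr0.
by rewrite inE/= in_itv/= andbT; exact: (pk_bound hphi).
Qed.

Let phi0M (x y : {nonneg R}) t : 0 < t ->
  phi0 (x%:num * t) * phi0 (y%:num * t) =
  \int[op (delta x) (delta y)]_s phi0 (s * t).
Proof.
move=> t0; have phiE (z : {nonneg R}) : phi0 (z%:num * t) = phi (z%:num * t).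
  by rewrite phi0E// mulr_ge0// ltW.
rewrite !phiE (pk_mult hphi); last exact: ltW.
rewrite Rintegral_mkcond; apply: eq_Rintegral => s _.
by rewrite /phi0 !patchE !mem_setE !in_itv/= !andbT pmulr_lge0.
Qed.

Let conv_gt0 (x y : {nonneg R}) : 0 < x%:num ->
  op (delta x) (delta y) `]0, +oo[%classic = 1%E.
Proof.
move=> x0; apply/eqP; rewrite eq_le probability_le1//= -(hmono x y).
apply: le_measure; rewrite ?inE//; apply: subset_itvr.
by rewrite bnd_simp lt_max x0.
Qed.

(** The absolute value only supplies a nonnegative argument; the relevant range is [0 < r <= 1]. *)
Let M (r : R) : probability (measurableTypeR R) R :=
  op (delta 1%:nng) (delta `|r|%:nng).

Let M1 r : 0 < r <= 1 -> M r `[1, +oo[%classic = 1%E.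
Proof.
move=> /andP[r0 r1]; rewrite -(hmono 1%:nng `|r|%:nng)/=.
by rewrite max_l// gtr0_norm.
Qed.

Let transform_delta (a : {nonneg R}) t : 0 <= t ->
  transform phi (delta a) t = phi (t * a%:num).
Proof.
move=> t0; rewrite /transform /Rintegral/= integral_dirac//=.
  by rewrite /indic mem_set ?mul1r//= in_itv/= andbT.
apply/measurable_EFinP.
apply: (eq_measurable_fun (T1 := measurableTypeR R) (T2 := R)
  (fun s => phi0 (s * t))).
  by move=> s; rewrite inE/= in_itv/= andbT => s0; rewrite phi0E ?mulr_ge0// mulrC.
exact: measurable_funTS (unit_comp_scale t phi0_unit).1.
Qed.

(** Otherwise the unit masses at 1 and 2 would have the same transform. *)
Lemma kernel_nonconstant c : (forall t, 0 < t -> phi t = c) -> False.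
Proof.
move=> phic.
have d12 : delta (1%:nng : {nonneg R}) ≡μ delta (2%:nng : {nonneg R}).
  apply: (pk_separates hphi) => t t0; rewrite !transform_delta//=.
  move: t0; rewrite le_eqVlt => /predU1P[<-|t0]; first by rewrite !mul0r.
  by rewrite !phic// mulr_gt0.
have := d12 [set 1] (measurable_set1 _).
rewrite /= !diracE mem_set// memNset//=; last by move=> h; have : 2 = 1 :> R := h; lra.
by move=> /eqP; rewrite eqe oner_eq0.
Qed.

(** * Consequences of a tail law *)

Section tail_law_theory.
Context {nu : probability (measurableTypeR R) R} (hnu : tail_law phi nu).

Let p t := mass nu `]t, +oo[%classic.
Let q t := mass nu `[t, +oo[%classic.
Let pq : tails p q := tails_probability nu.

Let cpq : countable [set t | p t != q t].
Proof.
apply: sub_countable (atoms_countable nu).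
apply: subset_card_le => t /= ptq.
rewrite -tails_probability_jump subr_gt0 lt_neqAle ptq.
exact: (tails_le pq).
Qed.

Let phi0p t : 0 < t -> p t = q t -> phi0 t = p t.
Proof.
move=> t0 ptq; rewrite phi0E ?ltW// hnu.2//.
by rewrite -tails_probability_jump -/(p t) ptq subrr.
Qed.

Lemma tail_law_conv (x y : {nonneg R}) t : 0 < x%:num -> 0 < y%:num -> 0 < t ->
  p (x%:num * t) * p (y%:num * t) = \int[op (delta x) (delta y)]_s p (s * t)
  /\ q (x%:num * t) * q (y%:num * t) = \int[op (delta x) (delta y)]_s q (s * t).
Proof.
move=> x0 y0 t0; split.
  exact: (tails_transfer_right pq cpq (conv_gt0 y x0) x0 y0 phi0_unit phi0p
    (phi0M x y)).
exact: (tails_transfer_left pq cpq (conv_gt0 y x0) x0 y0 phi0_unit phi0p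
  (phi0M x y)).
Qed.

Let mult_pq : multiplicative M p /\ multiplicative M q.
Proof.
split=> r t /andP[r0 r1] t0; have rE : `|r| * t = r * t by rewrite gtr0_norm.
- have [] := @tail_law_conv 1%:nng `|r|%:nng t ltr01 _ t0.
    by rewrite /= normr_gt0 gt_eqF.
  by rewrite /= mul1r rE.
- have [] := @tail_law_conv 1%:nng `|r|%:nng t ltr01 _ t0.
    by rewrite /= normr_gt0 gt_eqF.
  by rewrite /= mul1r rE.
Qed.

Let p0 : p 0 = 1.
Proof. by rewrite /p /mass hnu.1. Qed.

Let p_small e : 0 < e -> exists t, p t < e.
Proof.
move=> e0.
pose F n := `]n%:R, +oo[%classic : set (measurableTypeR R).
have : mass nu (F n) @[n --> \oo] --> mass nu (\bigcap_n F n).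
  apply: mass_cvg_nonincreasing => [n|n k nk]; first exact: measurable_itv.
  by apply/subsetPset; apply: subset_itvr; rewrite bnd_simp ler_nat.
have -> : \bigcap_n F n = set0.
  rewrite -subset0 => x /(_ (Num.truncn x).+1 I).
  rewrite /F/= in_itv/= andbT ltNge => /negP; apply.
  exact/ltW/truncnS_gt.
rewrite /mass measure0/= => /cvgrPdist_lt/(_ _ e0)[N _ /(_ N (leqnn N))] /=.
rewrite sub0r normrN => pN; exists N%:R.
exact: le_lt_trans (ler_norm _) pN.
Qed.

Lemma tail_law_nonincreasing :
  (forall s t, 0 <= s -> s <= t -> phi t <= phi s) /\
  phi t @[t --> +oo] --> (0 : R).
Proof.
have [mp mq] := mult_pq.
have phi0_mult : multiplicative M phi0.
  move=> r t /andP[r0 r1] t0.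
  have rE : `|r| * t = r * t by rewrite gtr0_norm.
  have h := phi0M (1%:nng : {nonneg R}) (`|r|%:nng : {nonneg R}) t0.
  rewrite -rE -[X in phi0 X * _]mul1r. exact: h.
have pqphi := multiplicative_dichotomy M1 pq mp mq p0 p_small phi0_unit
  phi0_mult phi0p.
have phi_le t : 0 < t -> p t <= phi t <= q t.
  move=> t0; rewrite -(phi0E (ltW t0)).
  by case: pqphi => h; rewrite h//; apply/andP; split => //; exact: (tails_le pq).
split.
  move=> s t; rewrite le_eqVlt => /predU1P[<-|s0] st.
    by rewrite (pk_one hphi) (le_trans (ler_norm _))// (pk_bound hphi).
  have t0 : 0 < t by exact: lt_le_trans st.
  rewrite -(phi0E (ltW s0)) -(phi0E (ltW t0)); case: pqphi => h; rewrite !h//.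
    exact: (tails_p_le pq).
  exact: (tails_q_le pq).
apply/cvgrPdist_lt => e /p_small[t pt]; near=> s.
have s0 : 0 < s by near: s; apply: nbhs_pinfty_gt; exact: num_real.
have ts : t < s by near: s; apply: nbhs_pinfty_gt; exact: num_real.
have := tails_lt pq ts; have := tails_ge0 pq s; have /andP[] := phi_le _ s0.
by move=> h1 h2 h3 h4; rewrite sub0r normrN ger0_norm; lra.
Unshelve. all: by end_near. Qed.

(** For positive [x] and [y] this is the transferred formula at argument 1; a zero is handled by the
    neutrality of [delta 0%:nng]. *)
Lemma tail_law_memoryless (x y : {nonneg R}) :
  \int[op (delta x) (delta y)]_s p s = p x%:num * p y%:num.
Proof.
have pdelta (z : {nonneg R}) (P : pplus R) : P ≡μ delta z ->
    \int[P]_s p s = p z%:num.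
  by move/Rintegral_delta; apply; exact: (tails_p_unit pq).
have [x0|x0] := eqVneq x 0%:nng.
  rewrite x0 /= p0 mul1r; apply: pdelta => A mA.
  by rewrite (gc_comm hop)// (gc_unit hop).
have [y0|y0] := eqVneq y 0%:nng.
  by rewrite y0 /= p0 mulr1; apply: pdelta => A mA; rewrite (gc_unit hop).
have xp : 0 < x%:num by rewrite lt_neqAle ge0 andbT eq_sym.
have yp : 0 < y%:num by rewrite lt_neqAle ge0 andbT eq_sym.
have [] := tail_law_conv xp yp ltr01; rewrite !mulr1 => -> _.
by apply: eq_Rintegral => s _; rewrite mulr1.
Qed.

End tail_law_theory.


Let phi0_limit_idempotent (u_ : R^nat) (l : R) : (forall n, 0 < u_ n) ->
  (forall s, 0 < s -> phi (s * u_ n) @[n --> \oo] --> l) -> l = 0 \/ l = 1.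
Proof.
move=> u0 cvgs.
have ll : l * l = l.
  apply: (limit_idempotent (P := op (delta 1%:nng) (delta 1%:nng))
    (chi := phi0) (u_ := u_)) => // [|n|s s0].
  - exact: conv_gt0.
  - have := phi0M (1%:nng : {nonneg R}) (1%:nng : {nonneg R}) (u0 n).
    by rewrite /= mul1r.
  - rewrite (_ : (fun n => _) = fun n => phi (s * u_ n)); first exact: cvgs.
    by apply/funext => n; rewrite phi0E// mulr_ge0// ltW.
have /eqP : l * (l - 1) = 0 by rewrite mulrBr mulr1 ll subrr.
by rewrite mulf_eq0 subr_eq0 => /orP[]/eqP ->; [left|right].
Qed.

Lemma nonincreasing_tail_law :
  (forall s t, 0 <= s -> s <= t -> phi t <= phi s) ->
  phi t @[t --> +oo] --> (0 : R) -> exists nu, tail_law phi nu.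
Proof.
move=> phi_le phi_oo.
have phi_le1 t : 0 <= t -> phi t <= 1.
  by move=> t0; rewrite -(pk_one hphi) phi_le.
have phi_ge0 t : 0 <= t -> 0 <= phi t.
  move=> t0; rewrite leNgt; apply/negP => phit0.
  have phi_gt : \forall s \near +oo, phi t < phi s by exact: cvgr_gt phit0.
  near (pinfty_nbhs R) => s.
  have ts : t <= s by near: s; apply: nbhs_pinfty_ge; exact: num_real.
  have : phi t < phi s by near: s.
  by rewrite ltNge phi_le.
pose f u := if u < 0 then 0 else 1 - phi u.
have fE t : 0 <= t -> 1 - f t = phi t.
  by move=> t0; rewrite /f ltNge t0/= opprB addrC subrK.
have [nu hnu] : exists nu : probability (measurableTypeR R) R, forall t,
    mass nu `]t, +oo[%classic <= 1 - f t <= mass nu `[t, +oo[%classic.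
  apply: law_of_nondecreasing.
  - move=> x y xy; rewrite /f; case: (ltP x 0) => x0; case: (ltP y 0) => y0 //.
    + by rewrite subr_ge0 phi_le1.
    + by have := le_trans x0 xy; rewrite leNgt y0.
    + by rewrite lerD2l lerN2 phi_le.
  - move=> t; rewrite /f; case: (ltP t 0) => t0; first by rewrite lexx ler01.
    by rewrite subr_ge0 phi_le1// gerBl phi_ge0.
  - by exists (-1); rewrite /f oppr_lt0 ltr01.
  - have h : 1 - phi t @[t --> +oo] --> (1 - 0 : R).
      by apply: cvgB => //; exact: cvg_cst.
    rewrite subr0 in h; apply: cvg_trans h; apply: near_eq_cvg.
    near=> s; rewrite /f ltNge.
    have -> : 0 <= s by near: s; apply: nbhs_pinfty_ge; exact: num_real.
    by [].
have pq := tails_probability nu.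
have phi_pq t : 0 <= t ->
    mass nu `]t, +oo[%classic <= phi t <= mass nu `[t, +oo[%classic.
  by move=> t0; rewrite -fE.
(* The mass of []0, +oo[] is the limit of [phi] at 0, hence idempotent. The value 0 would make [phi]
   vanish on []0, +oo[]. *)
have [p0|p0] : mass nu `]0, +oo[%classic = 0 \/ mass nu `]0, +oo[%classic = 1.
  apply: (@phi0_limit_idempotent (fun n => n.+1%:R^-1)) => [n//|s s0].
  have su : s * n.+1%:R^-1 @[n --> \oo] --> 0.
    rewrite -[X in _ --> X](mulr0 s).
    by apply: cvgM; [exact: cvg_cst|exact: cvg_harmonic].
  have su0 n : 0 < s * n.+1%:R^-1 by rewrite mulr_gt0.
  apply: (@squeeze_cvgr _ _ _ _
    (fun n => mass nu `](s * n.+1%:R^-1), +oo[%classic)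
    (cst (mass nu `]0, +oo[%classic))).
  - apply: nearW => n; have /andP[-> h] := phi_pq _ (ltW (su0 n)).
    exact: le_trans h (tails_lt pq (su0 n)).
  - exact: (tails_right_cvg pq su0 su).
  - exact: cvg_cst.
  exfalso; apply: (kernel_nonconstant (c := 0)) => t t0.
  have /andP[h1 h2] := phi_pq _ (ltW t0).
  apply/eqP; rewrite eq_le -{1}p0 (le_trans h2 (tails_lt pq t0))/=.
  exact: le_trans (tails_ge0 pq t) h1.
exists nu; split.
  by rewrite -(massK nu (measurable_itv _)) p0.
move=> t t0 nut; have := phi_pq _ (ltW t0).
rewrite mass_itv_obnd// nut add0r => h.
by apply/eqP; rewrite eq_sym eq_le.
Unshelve. all: by end_near. Qed.

Let z0 : {nonneg R} := 0%:nng.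

(** At [x = y = 0] memorylessness reads [a = a * a] for the mass [a] of []0, +oo[], and [a = 0]
    would make [nu] the unit mass at 0. *)
Lemma lack_of_memory_tail_law (nu : pplus R) : lack_of_memory op nu ->
  is_cdf_of (fun t : R => (1 - phi t) * \1_`[0, +oo[ t) nu -> tail_law phi nu.
Proof.
move=> [nu_delta nu_mem] nu_cdf.
pose a := mass nu `]0, +oo[%classic.
have nu_gt0 : nu `]0, +oo[%classic = a%:E by rewrite massK.
have aa : a * a = a.
  have tail0 := Rintegral_delta (gc_unit hop (delta z0))
    (tails_p_unit (tails_probability nu)).
  have h : a%:E = (nu `]0%R, +oo[%classic * nu `]0%R, +oo[%classic)%E :=
    etrans (congr1 EFin (esym tail0))
      (etrans (esym (product_tail nu _)) (nu_mem z0 z0)).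
  by rewrite nu_gt0 -EFinM in h; case: h => <-.
have a1 : a = 1.
  have /eqP : a * (a - 1) = 0 by rewrite mulrBr mulr1 aa subrr.
  rewrite mulf_eq0 subr_eq0 => /orP[]/eqP// a0; exfalso; apply: nu_delta.
  have nu0 : mass nu [set 0] = 1.
    have : mass nu `[0, +oo[%classic = 1 by rewrite /mass law_ge0.
    by rewrite mass_itv_obnd// -/a a0 addr0.
  have m0 : measurable [set 0 : measurableTypeR R] by exact: measurable_set1.
  move=> A mA; apply: (etrans (esym (massK nu mA))); rewrite /= diracE; congr EFin.
  apply/eqP; have [/set_mem A0|/negP A0] := boolP (_ \in _).
    rewrite eq_le mass_le1//= -nu0; apply: le_mass => //.
    by move=> _ ->.
  rewrite eq_le mass_ge0 andbT.
  have : mass nu A <= mass nu (~` [set 0]).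
    apply: le_mass => //; first exact: measurableC.
    by move=> x Ax /= x0; apply: A0; rewrite inE -x0.
  have -> // : mass nu (~` [set 0]) = 0.
  rewrite /mass probability_setC// -(massK nu m0) nu0.
  by rewrite subee.
split; first by rewrite nu_gt0 a1.
move=> t t0 nut.
have := nu_cdf t; rewrite cdf_continuousP => /(_ nut).
rewrite -/(mass nu _) mass_NyitvE /indic mem_set ?mulr1; last first.
  by rewrite /= in_itv/= ltW.
by lra.
Qed.

Lemma tail_law_lack_of_memory (nu : probability (measurableTypeR R) R) :
  tail_law phi nu -> exists nu' : pplus R, lack_of_memory op nu' /\
    is_cdf_of (fun t : R => (1 - phi t) * \1_`[0, +oo[ t) nu'.
Proof.
move=> hnu; have nu0 := hnu.1.
have nu_ge0 : nu `[0, +oo[%classic = 1%E.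
  apply/eqP; rewrite eq_le probability_le1//= -nu0.
  by apply: le_measure; rewrite ?inE//; apply: subset_itvr; rewrite bnd_simp.
exists (Pplus nu_ge0); split; first split.
- move=> /(_ `]0, +oo[%classic (measurable_itv _)) /=.
  rewrite nu0 diracE memNset/=; last by rewrite in_itv/= ltxx.
  by move=> /eqP; rewrite eqe oner_eq0.
- move=> x y; apply: (etrans (product_tail nu _)).
  by rewrite (tail_law_memoryless hnu) EFinM !massK.
move=> t /cdf_continuousP/= nut; rewrite -/(mass nu _) mass_NyitvE.
have [t0|t0|t0] := ltgtP t 0.
- rewrite /indic memNset ?mulr0; last by rewrite /= in_itv/= andbT leNgt t0.
  have := tails_lt (tails_probability nu) t0.
  have -> : mass nu `[0, +oo[%classic = 1 by rewrite /mass nu_ge0.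
  have := tails_p_le1 (tails_probability nu) t.
  by rewrite /=; lra.
- rewrite /indic mem_set ?mulr1; last by rewrite /= in_itv/= andbT ltW.
  by rewrite hnu.2.
- rewrite t0 /indic mem_set ?mulr1; last by rewrite /= in_itv/= lexx.
  by rewrite (pk_one hphi) /mass nu0.
Qed.

Lemma tail_law_reciprocal_cdf (nu : probability (measurableTypeR R) R) :
  tail_law phi nu -> exists mu : probability (measurableTypeR R) R,
    is_cdf_of (fun t : R => (if t == 0 then 0 else phi t^-1) * \1_`[0, +oo[ t) mu.
Proof.
move=> [nu0 nuphi]; have [mu [mu0 mu1 mu_tail]] := reciprocal_law nu0.
exists mu => t /cdf_continuousP mut; rewrite -/(mass mu _) mass_NyitvE.
have [t0|t0|t0] := ltgtP t 0.
- rewrite /indic memNset ?mulr0; last by rewrite /= in_itv/= andbT leNgt t0.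
  have := tails_p_le (tails_probability mu) (ltW t0).
  have -> : mass mu `]0, +oo[%classic = 1 by rewrite /mass mu0.
  have := tails_p_le1 (tails_probability mu) t.
  by rewrite /=; lra.
- rewrite /indic mem_set ?mulr1; last by rewrite /= in_itv/= andbT ltW.
  have nut : mass nu [set t^-1] = 0 by rewrite -mu1.
  rewrite mu_tail// opprB addrC subrK nuphi ?invr_gt0//.
  by rewrite mass_itv_obnd// nut add0r.
- by rewrite mul0r t0 /mass mu0 subrr.
Qed.

Lemma reciprocal_cdf_tail_law (phi_oo : R)
    (mu : probability (measurableTypeR R) R) :
  phi t @[t --> +oo] --> phi_oo ->
  is_cdf_of (fun t : R =>
    (if t == 0 then phi_oo else phi t^-1) * \1_`[0, +oo[ t) mu ->
  exists nu, tail_law phi nu.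
Proof.
move=> phi_cvg mu_cdf; have pq := tails_probability mu.
have phiE t : 0 < t -> mass mu [set t] = 0 ->
    phi t^-1 = 1 - mass mu `]t, +oo[%classic.
  move=> t0 mut; have := mu_cdf t; rewrite cdf_continuousP => /(_ mut).
  rewrite gt_eqF// -/(mass mu _) mass_NyitvE /indic mem_set ?mulr1//.
  by rewrite /= in_itv/= andbT ltW.
(* Along points [u_ n] without atom tending to 0 from the right, [phi (u_ n)^-1] tends to [phi_oo]
   and the distribution function to its value at 0. *)
have phi_ooE : phi_oo = 1 - mass mu `]0, +oo[%classic.
  have /choice[u_ hu] n : exists u, 0 < u < n.+1%:R^-1 /\ mass mu [set u] = 0.
    have := @tails_eq _ _ _ pq 0 n.+1%:R^-1; rewrite invr_gt0 ltr0n.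
    move=> /(_ isT)[u u0 uE]; exists u; split => //.
    by rewrite -tails_probability_jump uE subrr.
  have u0 n : 0 < u_ n by have [/andP[]] := hu n.
  have ucvg : u_ n @[n --> \oo] --> 0.
    apply: (@squeeze_cvgr _ _ _ _ (cst 0) (fun n => n.+1%:R^-1)).
    - by apply: nearW => n; have [/andP[/ltW -> /ltW ->]] := hu n.
    - exact: cvg_cst.
    - exact: cvg_harmonic.
  have lim1 : 1 - mass mu `]u_ n, +oo[%classic @[n --> \oo] -->
      1 - mass mu `]0, +oo[%classic.
    by apply: cvgB; [exact: cvg_cst|exact: (tails_right_cvg pq u0 ucvg)].
  have lim2 : phi (u_ n)^-1 @[n --> \oo] --> phi_oo.
    move/cvg_pinftyP : phi_cvg; apply.
    by apply/cvgrVy => //; exact: nearW.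
  rewrite (_ : (fun n => _) = fun n => 1 - mass mu `]u_ n, +oo[%classic) in lim2.
    exact: (cvg_unique _ lim2 lim1).
  by apply/funext => n; rewrite phiE//; have [] := hu n.
have [phi_oo0|phi_oo1] : phi_oo = 0 \/ phi_oo = 1.
  apply: (@phi0_limit_idempotent (fun n => n.+1%:R)) => [n//|s s0].
  move/cvg_pinftyP : phi_cvg; apply.
  rewrite (_ : (fun n => _) = fun n => (s^-1 * n.+1%:R^-1)^-1); last first.
    by apply/funext => n; rewrite invfM !invrK.
  apply/cvgrVy; first by apply: nearW => n; rewrite mulr_gt0 ?invr_gt0.
  rewrite -[X in _ --> X](mulr0 s^-1).
  by apply: cvgM; [exact: cvg_cst|exact: cvg_harmonic].
  have mu0 : mu `]0, +oo[%classic = 1%E.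
    by rewrite -(massK mu (measurable_itv _)); congr EFin; lra.
  have [nu [nu0 nu1 nu_tail]] := reciprocal_law mu0.
  exists nu; split => // t t0; rewrite nu1// => mut.
  rewrite nu_tail// mass_itv_obnd// mut add0r -phiE ?invr_gt0// invrK//.
(* If [phi_oo = 1], then [mu] has no mass on []0, +oo[], which makes [phi] equal to 1 there. *)
exfalso; apply: (kernel_nonconstant (c := 1)) => t t0.
have mu0 : mass mu `]0, +oo[%classic = 0 by lra.
have t0' : 0 < t^-1 by rewrite invr_gt0.
have mut : mass mu [set t^-1] = 0.
  apply/eqP; rewrite eq_le mass_ge0 andbT -mu0.
  by apply: le_mass => // _ ->; rewrite /= in_itv/= t0'.
rewrite -[t]invrK phiE//.
have := tails_p_le pq (ltW t0'); have := tails_ge0 pq t^-1.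
by rewrite mu0; lra.
Qed.

End kernel.

Theorem theorem4 (R : realType) (op : pplus R -> pplus R -> pplus R)
    (phi : R -> R) (hop : generalized_convolution op) (hmono : monotonic_gc op)
    (hphi : is_probability_kernel op phi) :
  let cond1 :=
    (forall s t : R, 0 <= s -> s <= t -> phi t <= phi s) /\
    phi t @[t --> +oo] --> (0 : R) in
  let cond2 :=
    exists nu : pplus R, lack_of_memory op nu /\
      is_cdf_of (fun t : R => (1 - phi t) * \1_`[0, +oo[ t) nu in
  let cond3 :=
    exists phi_oo : R, phi t @[t --> +oo] --> phi_oo /\
      exists mu : probability (measurableTypeR R) R,
        is_cdf_of (fun t : R =>
          (if t == 0 then phi_oo else phi t^-1) * \1_`[0, +oo[ t) mu in
  (cond1 <-> cond2) /\ (cond2 <-> cond3).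
Proof.
move=> cond1 cond2 cond3.
have tail1 nu : tail_law phi nu -> cond1 by exact: tail_law_nonincreasing.
have tail2 nu : tail_law phi nu -> cond2 by exact: tail_law_lack_of_memory.
have tail3 nu : tail_law phi nu -> cond3.
  move=> hnu; exists 0; split; first exact: (tail1 nu hnu).2.
  exact: tail_law_reciprocal_cdf hnu.
have from1 : cond1 -> exists nu, tail_law phi nu.
  by case; exact: (nonincreasing_tail_law hmono hphi).
have from2 : cond2 -> exists nu, tail_law phi nu.
  by case=> nu [nu_mem nu_cdf]; exists nu; exact: (lack_of_memory_tail_law hop).
have from3 : cond3 -> exists nu, tail_law phi nu.
  case=> phi_oo [phi_cvg [mu mu_cdf]].
  exact: (reciprocal_cdf_tail_law hmono hphi phi_cvg mu_cdf).
split; split.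
- by move=> /from1[nu]; exact: tail2.
- by move=> /from2[nu]; exact: tail1.
- by move=> /from2[nu]; exact: tail3.
- by move=> /from3[nu]; exact: tail2.
Qed.
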